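(* Let $G$ be a canonical weighted graph with labeled graph groupoid $\mathbb{G}$, and let $T_G$ be the labeling operator of $\mathbb{G}$ on $H_G$. Then: (1) $T_G$ is a $\mathbb{D}_G$-free sum of the $\mathbb{D}_G$-free elements $T_k+T_{-k}$, $k=1,\dots,N$, in the right graph von Neumann algebra $\mathbb{M}_G$; that is, $T_G=\sum_{k=1}^N(T_k+T_{-k})$ and the operators $T_k+T_{-k}$, $k=1,\dots,N$, are free over $\mathbb{D}_G$ from each other in $(\mathbb{M}_G,E)$. (2) $T_G$ is self-adjoint on $H_G$.
   Context: $G$ is a countable directed graph with vertex set $V(G)$ and edge set $E(G)$, locally finite (every vertex has finitely many incident edges) and connected (any two distinct vertices are joined by a reduced finite path of $\widehat G$, defined below). $\deg_{out}(v)$ is the number of edges of $E(G)$ with initial vertex $v$, and $N:=\max\{\deg_{out}(v):v\in V(G)\}$, assumed finite. The shadow $G^{-1}$ has the same vertices and the opposite edges $e^{-1}$, $e\in E(G)$; the shadowed graph $\widehat G$ has vertex set $V(G)$ and edge set $E(G)\sqcup E(G^{-1})$. The graph groupoid $\mathbb{G}$ consists of the empty word $\emptyset$, the vertices, and the reduced finite paths of $\widehat G$, with product given by concatenation followed by the reduction $ww^{-1}=v$, $w^{-1}w=v'$ for $w$ a path from $v$ to $v'$; non-composable products equal $\emptyset$. Labels: $x_j$ is the $j$-th standard basis vector of $\mathbb{C}^N$. For each vertex $v$ the edges of $G$ with initial vertex $v$ are given the distinct labels $x_1,\dots,x_{\deg_{out}(v)}$, and $e^{-1}$ gets minus the label of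 $e$. Write $\widetilde\omega(e)$ for the label of $e\in E(\widehat G)$. $G$ with these labels is a canonical weighted graph and $\mathbb{G}$ the labeled graph groupoid. $H_G$ is the Hilbert space with orthonormal basis $\{\xi_w\}$ indexed by the elements $w\neq\emptyset$ of $\mathbb{G}$, with $\xi_\emptyset=0$. For $w\in\mathbb{G}$ the right multiplication operator $R_w$ is $R_w\xi_{w'}=\xi_{w'w}$; $R_w^*=R_{w^{-1}}$. The right graph von Neumann algebra $\mathbb{M}_G\subset B(H_G)$ is the von Neumann algebra generated by $\{R_w:w\in\mathbb{G}\}$; its elements are written $\sum_{w\in\mathbb{G}}m_wR_w$, $m_w\in\mathbb{C}$. $\mathbb{D}_G=\bigoplus_{v\in V(G)}\mathbb{C}R_v$ is its diagonal subalgebra and $E:\mathbb{M}_G\to\mathbb{D}_G$, $E(\sum_w m_wR_w)=\sum_{v\in V(G)}m_vR_v$, the canonical conditional expectation. Put $t_k=x_k$, $t_{-k}=-x_k$ for $k=1,\dots,N$. The $k$-th labeling operator is $T_k=\sum_{e\in E(\widehat G),\,\widetilde\omega(e)=t_k}R_e$ ($k=\pm1,\dots,\pm N$), and the labeling operator is $T_G=\sum_{j=-N}^{-1}T_j+\sum_{i=1}^NT_i$. Elements are free over $\mathbb{D}_G$ if the von Neumann algebras generated by each of them together with $\mathbb{D}_G$ are free with amalgamation over $\mathbb{D}_G$ with respect to $E$ (equivalently all mixed $\mathbb{D}_G$-valued $*$-cumulants vanish).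
   Formalization: It is additionally assumed that each sum defining T_k (k=±1,…,±N) converges unconditionally in the strong operator topology to a bounded operator; this can fail when the numbers of edges with one label ending at a vertex are unbounded, and then T_G is not in M_G. *)

(* Defs.v *)
From HB Require Import structures.
From mathcomp Require Import all_boot all_order all_algebra finmap.
From mathcomp Require Import all_classical all_reals all_analysis.
From mathcomp Require Import complex ring.
From mathcomp.analysis.showcase Require summability.

Set Implicit Arguments.
Unset Strict Implicit.
Unset Printing Implicit Defensive.

Import Order.TTheory GRing.Theory Num.Theory.
Import numFieldNormedType.Exports.

Local Open Scope classical_set_scope.
Local Open Scope ring_scope.
Local Open Scope complex_scope.

Notation normc := ComplexField.Normc.normc.

Section Ell2.
Variables (R : realType) (I : choiceType).

Definition sqsum (f : I -> R[i]) : \bar R :=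
  (\esum_(i in [set: I]) (normc (f i) ^+ 2)%:E)%R.

Definition ell2_pred : {pred I -> R[i]} := [pred f | `[< (sqsum f < +oo)%E >]].

Lemma sqsum_ge0 f : (0 <= sqsum f)%E.
Proof. by apply: esum_ge0 => i _; rewrite lee_fin sqr_ge0. Qed.

Lemma normc_nneg (z : R[i]) : 0 <= normc z.
Proof. by case: z => a b; rewrite /= sqrtr_ge0. Qed.

Lemma ell2_submod_closed : submod_closed ell2_pred.
Proof.
split.
  apply/asboolP; rewrite /sqsum esum1 ?ltry// => i _.
  by rewrite ComplexField.Normc.normc0 expr0n.
move=> c f g /asboolP fP /asboolP gP; apply/asboolP.
pose k := (2 * normc c ^+ 2).
have k0 : 0 <= k by rewrite mulr_ge0// sqr_ge0.
pose kf i : \bar R := (k * normc (f i) ^+ 2)%:E.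
pose kg i : \bar R := (2 * normc (g i) ^+ 2)%:E.
have scl (a : R) (h : I -> R[i]) : 0 <= a -> (sqsum h < +oo)%E ->
    ((\esum_(i in [set: I]) (a * normc (h i) ^+ 2)%:E)%R < +oo)%E.
  move=> a0 hfin; apply: (@le_lt_trans _ _ (a%:E * sqsum h)%E); last first.
    have : sqsum h \is a fin_num by rewrite ge0_fin_numE ?sqsum_ge0.
    by move=> /fineK <-; rewrite -EFinM ltry.
  apply: ge_ereal_sup => _ [X [finX _] <-].
  under eq_fsbigr do rewrite EFinM.
  rewrite -ge0_mule_fsumr; last by move=> i; rewrite lee_fin sqr_ge0.
  apply: lee_pmul => //; first by apply: fsume_ge0 => i _; rewrite lee_fin sqr_ge0.
  by apply: esum_ge; exists X.
apply: (@le_lt_trans _ _ (\esum_(i in [set: I]) (kf i + kg i)%E)).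
  apply: le_esum => i _; rewrite -EFinD lee_fin /k.
  have := ComplexField.Normc.normcM c (f i).
  have := le_normcD (c * f i) (g i).
  have := normc_nneg (c * f i + g i); have := normc_nneg (c * f i).
  have := normc_nneg (g i).
  have -> : (c *: f + g) i = c * f i + g i by [].
  move: (normc (c * f i + g i)) (normc (c * f i)) (normc (g i)) => x y z.
  move=> z0 y0 x0 xyz yE; rewrite -mulrA -exprMn -yE -subr_ge0.
  have : x ^+ 2 <= (y + z) ^+ 2 by rewrite ler_sqr ?nnegrE ?addr_ge0.
  have := sqr_ge0 (y - z); rewrite sqrrB sqrrD !mulr2n => h1 h2.
  rewrite subr_ge0; apply: (le_trans h2).
  rewrite -subr_ge0; apply: (le_trans h1).
  rewrite le_eqVlt; apply/orP; left; apply/eqP.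
  by ring.
rewrite esumD; first by rewrite lte_add_pinfty// scl.
- by move=> i _; rewrite lee_fin mulr_ge0// sqr_ge0.
- by move=> i _; rewrite lee_fin mulr_ge0// sqr_ge0.
Qed.

HB.instance Definition _ :=
  GRing.isSubmodClosed.Build R[i] (I -> R[i]) ell2_pred ell2_submod_closed.

Record ell2 := Ell2 { ell2_val :> I -> R[i]; _ : ell2_val \in ell2_pred }.

HB.instance Definition _ := [isSub for ell2_val].
HB.instance Definition _ := [Choice of ell2 by <:].
HB.instance Definition _ := [SubChoice_isSubLmodule of ell2 by <:].

Lemma sqsum_delta (i : I) : (sqsum (fun j => (j == i)%:R) < +oo)%E.
Proof.
rewrite /sqsum; suff -> : (\esum_(j in [set: I])
    (normc ((j == i)%:R : R[i]) ^+ 2)%:E)%R = 1%:E by rewrite ltry.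
rewrite -(@esum_set1 R I i (fun=> 1%:E))// esum_mkcond; apply: eq_esum => j _.
have [->|ji] := eqVneq j i.
  by rewrite ComplexField.Normc.normc1 expr1n mem_set.
by rewrite ComplexField.Normc.normc0 expr0n memNset//= => /eqP; apply/negP.
Qed.

Definition delta (i : I) : ell2 := Ell2 (asboolT (sqsum_delta i)).

Definition inner (f g : ell2) : R[i] :=
  summability.sum (fun i => f i * conjc (g i) : R[i]^o).

Definition l2norm (f : ell2) : R := Num.sqrt (fine (sqsum f)).

Definition bounded_op (T : ell2 -> ell2) : Prop :=
  linear T /\ exists M : R, forall f, l2norm (T f) <= M * l2norm f.

Definition adjoint (A B : ell2 -> ell2) : Prop :=
  forall f g, inner (A f) g = inner f (B g).

Definition selfadjoint (A : ell2 -> ell2) : Prop :=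
  bounded_op A /\ adjoint A A.

(* T is the sum of the operators a j, unconditionally in the strong operator
   topology. *)
Definition is_opsum (J : choiceType) (a : J -> ell2 -> ell2)
    (T : ell2 -> ell2) : Prop :=
  bounded_op T /\
  forall f, l2norm (T f - \sum_(j <- F) a j f) @[F --> summability.totally]
            --> (0 : R).

Definition opsummable (J : choiceType) (a : J -> ell2 -> ell2) : Prop :=
  exists T, is_opsum a T.

(* The sum in the sense of is_opsum when it exists, and 0 otherwise. *)
Definition opsum (J : choiceType) (a : J -> ell2 -> ell2) : ell2 -> ell2 :=
  xget 0 [set T | is_opsum a T].

Definition commutant (S : set (ell2 -> ell2)) : set (ell2 -> ell2) :=
  [set T | bounded_op T /\ forall A, S A -> T \o A = A \o T].

Definition vN_algebra (M : set (ell2 -> ell2)) : Prop :=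
  (forall A B, M A -> bounded_op B -> adjoint A B -> M B) /\
  commutant (commutant M) = M.

Definition vN_gen (S : set (ell2 -> ell2)) : set (ell2 -> ell2) :=
  \bigcap_(M in [set M | vN_algebra M /\ S `<=` M]) M.

(* Freeness of the subalgebras A k with amalgamation over D in (M, E):
   E vanishes on alternating products of E-centred elements. *)
Definition free_over (M D : set (ell2 -> ell2))
    (E : (ell2 -> ell2) -> (ell2 -> ell2))
    (K : Type) (A : K -> set (ell2 -> ell2)) : Prop :=
  (forall k, D `<=` A k /\ A k `<=` M) /\
  forall (n : nat) (k : nat -> K) (a : nat -> ell2 -> ell2),
    (forall i, (i < n)%N -> k i <> k i.+1) ->
    (forall i, (i <= n)%N -> A (k i) (a i) /\ E (a i) = 0) ->
    E (\big[(fun S T => S \o T)/idfun]_(0 <= i < n.+1) a i) = 0.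

Lemma sqsum_pull (phi : I -> option I) (f : I -> R[i]) :
  (forall i j, phi i = phi j -> phi i <> None -> i = j) ->
  (sqsum (fun i => oapp f 0%R (phi i)) <= sqsum f)%E.
Proof.
move=> phiI; pose P := [set i | phi i <> None]; pose e i := odflt i (phi i).
pose a i : \bar R := (normc (f i) ^+ 2)%:E.
have a0 i : (0 <= a i)%E by rewrite lee_fin sqr_ge0.
have eI : set_inj P e.
  move=> i j; rewrite !inE /P /e /=.
  case Ei: (phi i) => [x|]; case Ej: (phi j) => [y|]//= _ _ xy.
  by apply: phiI; rewrite ?Ei ?Ej ?xy.
rewrite /sqsum [leLHS](_ : _ = \esum_(i in P) a (e i)); last first.
  rewrite [RHS]esum_mkcond; apply: eq_esum => i _; rewrite /P /e /a.
  case Ei: (phi i) => [x|]; first by rewrite mem_set//= Ei.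
  rewrite memNset; last by rewrite /= Ei.
  by rewrite ComplexField.Normc.normc0 expr0n.
rewrite -(esum_image P e a)// esum_mkcond; apply: le_esum => i _.
by case: ifP => _; rewrite ?lexx ?a0.
Qed.

End Ell2.

Arguments delta {R I}.

Record digraph := Digraph {
  vert : countType;
  edge : countType;
  src : edge -> vert;
  tgt : edge -> vert }.

Section Groupoid.
Variable G : digraph.

Definition graph_locally_finite : Prop :=
  forall v, finite_set [set e | @src G e = v \/ @tgt G e = v].

Definition outdeg (v : vert G) : nat :=
  #|` fset_set [set e | @src G e = v]|.

Definition max_outdeg (N : nat) : Prop :=
  (forall v, (outdeg v <= N)%N) /\ exists v, outdeg v = N.

(* Edges of the shadowed graph: inl e is e and inr e is its shadow. *)
Definition sedge := (edge G + edge G)%type.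

HB.instance Definition _ := Countable.on sedge.

Definition ssrc (e : sedge) : vert G :=
  match e with inl e => src e | inr e => tgt e end.

Definition stgt (e : sedge) : vert G :=
  match e with inl e => tgt e | inr e => src e end.

Definition sinv (e : sedge) : sedge :=
  match e with inl e => inr e | inr e => inl e end.

Fixpoint walk (v : vert G) (p : seq sedge) : bool :=
  if p is e :: q then (ssrc e == v) && walk (stgt e) q else true.

Definition endpoint (v : vert G) (p : seq sedge) : vert G :=
  last v (map stgt p).

Definition reduced (p : seq sedge) : bool :=
  sorted (fun e f => f != sinv e) p.

(* A nonempty element of the graph groupoid: a start vertex and the (possibly
   empty) word of a reduced walk from it; the vertex v is (v, [::]). *)
Record rpath := RPath {
  rpath_val :> vert G * seq sedge;
  _ : walk rpath_val.1 rpath_val.2 && reduced rpath_val.2 }.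

HB.instance Definition _ := [isSub for rpath_val].
HB.instance Definition _ := [Countable of rpath by <:].

Definition rstart (w : rpath) : vert G := (val w).1.
Definition rword (w : rpath) : seq sedge := (val w).2.

Lemma rpathP (w : rpath) : walk (rstart w) (rword w) /\ reduced (rword w).
Proof. exact: (andP (valP w)). Qed.

Definition rend (w : rpath) : vert G := endpoint (rstart w) (rword w).

Definition rvert (v : vert G) : rpath := @RPath (v, [::]) isT.

Lemma redge_subproof (e : sedge) :
  walk (ssrc e) [:: e] && reduced [:: e].
Proof. by rewrite /= eqxx. Qed.

Definition redge (e : sedge) : rpath :=
  @RPath (ssrc e, [:: e]) (redge_subproof e).

Definition graph_connected : Prop :=
  forall u v, u <> v -> exists w : rpath, rstart w = u /\ rend w = v.

Definition cons_red (e : sedge) (p : seq sedge) : seq sedge :=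
  if p is f :: q then if f == sinv e then q else e :: p else [:: e].

Definition reduce (p : seq sedge) : seq sedge := foldr cons_red [::] p.

Lemma sinvK : involutive sinv. Proof. by case. Qed.
Lemma ssrc_inv e : ssrc (sinv e) = stgt e. Proof. by case: e. Qed.
Lemma stgt_inv e : stgt (sinv e) = ssrc e. Proof. by case: e. Qed.

Lemma walk_cat v p q :
  walk v (p ++ q) = walk v p && walk (endpoint v p) q.
Proof. by elim: p v => //= e p IHp v; rewrite IHp andbA. Qed.

Lemma endpoint_cat v p q : endpoint v (p ++ q) = endpoint (endpoint v p) q.
Proof. by rewrite /endpoint map_cat last_cat. Qed.

Lemma reduced_behead e p : reduced (e :: p) -> reduced p.
Proof. exact: path_sorted. Qed.

Lemma cons_red_reduced e p : reduced p -> reduced (cons_red e p).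
Proof.
case: p => //= f q rq; case: eqP => [_|/eqP fe]; first exact: path_sorted rq.
by rewrite /= fe.
Qed.

Lemma reduce_reduced p : reduced (reduce p).
Proof. by elim: p => //= e p; exact: cons_red_reduced. Qed.

Lemma walk_reduce v p :
  walk v p -> walk v (reduce p) /\ endpoint v (reduce p) = endpoint v p.
Proof.
elim: p v => //= e p IHp v /andP[/eqP <-{v} wp]; move: (IHp _ wp).
rewrite -/(reduce p) /endpoint /=; case: (reduce p) => [|f q] /=.
  by rewrite eqxx => -[].
have [->|_] := eqVneq f (sinv e) => /= -[/andP[/eqP fe wq] eq].
  by move: wq eq; rewrite stgt_inv.
by rewrite eqxx fe eqxx.
Qed.

Lemma gmul_subproof (w w' : rpath) : rend w == rstart w' ->
  walk (rstart w) (reduce (rword w ++ rword w')) &&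
  reduced (reduce (rword w ++ rword w')).
Proof.
move=> /eqP ww'; rewrite reduce_reduced andbT.
apply: (walk_reduce _).1; rewrite walk_cat -/(rend w) ww'.
by rewrite (rpathP w).1 (rpathP w').1.
Qed.

Definition winv (p : seq sedge) : seq sedge := rev (map sinv p).

Lemma endpoint_rev v p : walk v p -> endpoint (endpoint v p) (winv p) = v.
Proof.
case: p => // e p /= /andP[/eqP ev _].
by rewrite /winv /= rev_cons -cats1 endpoint_cat /endpoint /= stgt_inv ev.
Qed.

Lemma ginv_subproof (w : rpath) :
  walk (rend w) (winv (rword w)) &&
  reduced (winv (rword w)).
Proof.
have [wp rp] := rpathP w; rewrite /rend.
move: (rstart w) (rword w) wp rp => v p wp rp {w}.
apply/andP; split; last first.
  rewrite /reduced /winv rev_sorted sorted_map; apply: sub_sorted rp => e f /=.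
  by apply: contra => /eqP ->; rewrite sinvK.
elim: p v wp {rp} => //= e p IHp v /andP[/eqP <-] wp.
rewrite /winv /= rev_cons -cats1 walk_cat.
rewrite [endpoint _ (e :: p)](_ : _ = endpoint (stgt e) p)//.
rewrite -/(winv p) IHp//= andbT ssrc_inv.
by rewrite endpoint_rev.
Qed.

(* The product of the graph groupoid, whose empty word is None; insub never
   fails here, by gmul_subproof. *)
Definition gmul (a b : option rpath) : option rpath :=
  match a, b with
  | Some w, Some w' => if rend w == rstart w'
      then insub (rstart w, reduce (rword w ++ rword w')) else None
  | _, _ => None
  end.

Definition ginv (a : option rpath) : option rpath :=
  omap (fun w => @RPath (_, _) (ginv_subproof w)) a.

Lemma cons_redK e p : reduced p -> cons_red (sinv e) (cons_red e p) = p.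
Proof.
case: p => [|f q] /= rq; first by rewrite sinvK eqxx.
have [fe|fe] := eqVneq f (sinv e); last by rewrite /= sinvK eqxx.
case: q rq => [|g q] /=; first by rewrite fe.
by rewrite sinvK fe sinvK => /andP[/negPf ->].
Qed.

Lemma reduce_id p : reduced p -> reduce p = p.
Proof.
elim: p => //= e p IHp ep; rewrite -/(reduce p) IHp ?(reduced_behead ep)//.
by case: p ep {IHp} => //= f q /andP[/negPf ->].
Qed.

Lemma foldr_reduced s p : reduced s -> reduced (foldr cons_red s p).
Proof. by move=> rs; elim: p => //= e p; exact: cons_red_reduced. Qed.

Lemma foldr_reduce s p :
  reduced s -> foldr cons_red s (reduce p) = foldr cons_red s p.
Proof.
move=> rs; elim: p => //= e p <-; have := reduce_reduced p.
rewrite -/(reduce p); case: (reduce p) => //= f q _.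
case: eqP => // -> /=.
by have := cons_redK (sinv e) (foldr_reduced q rs); rewrite sinvK => ->.
Qed.

Lemma reduce_cat p q : reduce (p ++ q) = foldr cons_red (reduce q) p.
Proof. exact: foldr_cat. Qed.

Lemma foldr_winv p : foldr cons_red p (winv p) = [::].
Proof.
elim: p => //= e p IHp.
by rewrite /winv /= rev_cons -cats1 foldr_cat /= sinvK eqxx.
Qed.

Lemma winvK : involutive winv.
Proof. by move=> p; rewrite /winv map_rev revK mapK//; exact: sinvK. Qed.

Lemma gmulE (w w' : rpath) : rend w = rstart w' ->
  exists u : rpath, [/\ gmul (Some w) (Some w') = Some u,
    rstart u = rstart w, rend u = rend w' &
    rword u = reduce (rword w ++ rword w')].
Proof.
move=> /eqP ww'; have h := gmul_subproof ww'.
exists (@RPath (rstart w, reduce (rword w ++ rword w')) h).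
split=> //; first by rewrite /= ww' (@insubT _ _ rpath (_, _) h).
rewrite /rend /rstart /rword /=.
have ww : walk (rstart w) (rword w ++ rword w').
  by rewrite walk_cat -/(rend w) (eqP ww') (rpathP w).1 (rpathP w').1.
by have [_ ->] := walk_reduce ww; rewrite endpoint_cat -/(rend w) (eqP ww').
Qed.

Lemma rpath_inj (w w' : rpath) :
  rstart w = rstart w' -> rword w = rword w' -> w = w'.
Proof. by move=> h1 h2; apply/val_inj/injective_projections. Qed.

Lemma gmulK (w a b : option rpath) : w <> None -> a <> None ->
  gmul b (ginv w) = a -> gmul a w = b.
Proof.
case: w => // w _; case: a => // a _; case: b => //= b.
case: eqP => // bw.
have [//|u []] := @gmulE b (@RPath (_, _) (ginv_subproof w)).
rewrite /= bw eqxx => -> su eu wu [<-{a}].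
have uw : rend u = rstart w.
  by rewrite eu; apply: endpoint_rev; have [] := rpathP w.
have [//|b' []] := @gmulE u w.
rewrite /= uw eqxx => -> sb' eb' wb'; congr Some; apply: rpath_inj.
  by rewrite sb'.
rewrite wb' wu reduce_cat foldr_reduce ?reduce_reduced// foldr_cat.
rewrite (reduce_id (rpathP w).2) /= foldr_winv.
by rewrite -/(reduce _) reduce_id// (rpathP b).2.
Qed.

Lemma ginvK : involutive ginv.
Proof.
case=> //= w; congr Some; apply: rpath_inj; last exact: winvK.
by apply: endpoint_rev; have [] := rpathP w.
Qed.

End Groupoid.

Variant sign := Pos | Neg.

Section GraphOperators.
Variables (R : realType) (G : digraph).

Notation H := (ell2 R (rpath G)).

Definition xi (w : option (rpath G)) : H := oapp delta 0 w.

Lemma rmul_subproof (w : option (rpath G)) (f : H) :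
  (fun u => oapp f 0 (gmul (Some u) (ginv w))) \in @ell2_pred R (rpath G).
Proof.
apply/asboolP; apply: le_lt_trans (asboolW (valP f)).
apply: sqsum_pull => i j ij iN.
have wN : w <> None by move=> w0; move: iN; rewrite w0.
by have := gmulK wN iN (esym ij); rewrite (gmulK wN iN (erefl _)) => -[].
Qed.

(* The right multiplication operator R_w, by its values on functions:
   (R_w f)(u) = f (u w^-1), read as 0 when u w^-1 is the empty word. *)
Definition rmul (w : option (rpath G)) (f : H) : H :=
  Ell2 (rmul_subproof w f).

Lemma rmul_xi (w w' : option (rpath G)) : rmul w (xi w') = xi (gmul w' w).
Proof.
apply: val_inj; apply/funext => u.
change (oapp (xi w') 0 (gmul (Some u) (ginv w)) = xi (gmul w' w) u).
case: w' => [w'|]; last by case: (gmul (Some u) (ginv w)).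
case: w => [w|]; last by [].
have Kl x : gmul (Some u) (ginv (Some w)) = Some x ->
    gmul (Some x) (Some w) = Some u by exact: gmulK.
have Kr y : gmul (Some w') (Some w) = Some y ->
    gmul (Some y) (ginv (Some w)) = Some w'.
  by move=> h; apply: gmulK => //; rewrite ginvK.
case E1: (gmul (Some u) (ginv (Some w))) => [x|]; last first.
  case E2: (gmul (Some w') (Some w)) => [y|//].
  change (0 = (u == y)%:R :> R[i]); case: eqP => // uy.
  by move: E1; rewrite uy (Kr _ E2).
change ((x == w')%:R = xi (gmul (Some w') (Some w)) u).
have [xw|xw] := eqVneq x w'.
  rewrite -xw (Kl _ E1); change (1 = (u == u)%:R :> R[i]).
  by rewrite eqxx.
case E2: (gmul (Some w') (Some w)) => [y|//].
change (0 = (u == y)%:R :> R[i]); case: eqP => // uy.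
by move: E1; rewrite uy (Kr _ E2) => -[xw']; rewrite xw' eqxx in xw.
Qed.

Definition rvN : set (H -> H) := vN_gen (range rmul).

(* The coefficient m_w of T = \sum_w m_w R_w: the only summand that
   contributes to <T xi_v, xi_w>, where v is the initial vertex of w. *)
Definition coef (T : H -> H) (w : rpath G) : R[i] :=
  inner (T (delta (rvert (rstart w)))) (delta w).

Definition diagonal_alg : set (H -> H) :=
  [set T | exists d : vert G -> R[i],
    is_opsum (fun v => d v *: rmul (Some (rvert v))) T].

(* For T in rvN this sum always exists: the coefficients are bounded by the
   norm of T and the R_v are orthogonal projections with sum 1. *)
Definition condexp (T : H -> H) : H -> H :=
  opsum (fun v : vert G => coef T (rvert v) *: rmul (Some (rvert v))).

Variables (N : nat) (omega : edge G -> 'rV[R[i]]_N).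

(* x_1, ..., x_N are delta_mx 0 k for k : 'I_N, so indexed from 0. *)
Definition canonical_weight : Prop :=
  forall v, set_bij [set e | @src G e = v]
    [set delta_mx 0 k | k in [set k : 'I_N | (k < outdeg v)%N]] omega.

Definition slabel (e : sedge G) : 'rV[R[i]]_N :=
  match e with inl e => omega e | inr e => - omega e end.

(* t_k for Pos and t_{-k} for Neg. *)
Definition slabel_value (s : sign) (k : 'I_N) : 'rV[R[i]]_N :=
  match s with Pos => delta_mx 0 k | Neg => - delta_mx 0 k end.

Definition label_family (s : sign) (k : 'I_N)
    (e : {e : sedge G | slabel e == slabel_value s k}) : H -> H :=
  rmul (Some (redge (val e))).

(* The sum exists exactly when, over all vertices, the number of edges with
   label x_k ending there is bounded; see opsummable. *)
Definition klabeling (s : sign) (k : 'I_N) : H -> H :=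
  opsum (@label_family s k).

Definition labeling : H -> H :=
  \sum_(k < N) klabeling Neg k + \sum_(k < N) klabeling Pos k.

End GraphOperators.

Arguments label_family {R G N} omega s k e.
Arguments klabeling {R G N} omega s k.
Arguments labeling {R G N} omega.
Arguments rvN : clear implicits.
Arguments diagonal_alg : clear implicits.

(* Main.v *)
Require Import Defs.
From mathcomp Require Import all_boot all_order all_algebra finmap.
From mathcomp Require Import all_classical all_reals all_analysis.
From mathcomp Require Import complex ring lra.
From mathcomp.analysis.showcase Require Import summability.

Set Implicit Arguments.
Unset Strict Implicit.
Unset Printing Implicit Defensive.

Import Order.TTheory GRing.Theory Num.Theory.
Import numFieldNormedType.Exports.

Local Open Scope classical_set_scope.
Local Open Scope ring_scope.
Local Open Scope complex_scope.

(** Colour an edge e of the shadowed graph by k when its label is x_k or -x_k.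
    An edge has at most one colour, and e and e^-1 have the same colours. Write
    R_w and L_w for the right and left multiplications, xi_w for the basis
    vector of a path w, and A_k = T_k + T_{-k}.

    Freeness. A_k is a strong sum of operators R_e with e of colour k. These,
    and the R_v, commute with every L_w and with the projection P_k onto the
    closed span of the xi_w such that all edges of w have colour k. The set of
    these L_w and P_k is closed under adjoints, so its commutant is a von
    Neumann algebra, and it contains the algebra generated by A_k and the
    diagonal (rmul_commutant, vN_gen_color). Let a be an element of this
    commutant with E(a) = 0. Then a xi_v is supported on paths which start at
    v, have colour k, and are not reduced to the vertex v. For a path w with end
    v, L_w xi_v = xi_w, so a xi_w = L_w (a xi_v) is supported on products w w'
    with w' nonempty of colour k. When w does not end in colour k there is no
    cancellation in w w', which therefore ends in colour k (commutant_ends_in).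
    By induction along an alternating product of centred elements, its value at
    xi_v is supported on paths ending in the colour of the leftmost factor
    (alternating_product). No vertex is such a path, so all diagonal
    coefficients of the product vanish. This is the freeness of the A_k, once
    E(a) = 0 is known to mean that the diagonal coefficients of a vanish
    (condexp_eq0); the diagonal coefficients of a bounded operator are bounded,
    hence the sum defining E(a) exists.

    Self-adjointness. The matrix entry of T_k at (x, u) is 1 when x = u e for
    some e with label x_k, and 0 otherwise; and x = u e amounts to u = x e^-1.
    So the matrices of T_k and T_{-k} are transposes of one another
    (klabeling_entry, klabeling_adjoint).

    The analytic input is that the inner product converges and is bounded
    (inner_cvg, inner_bound) and that vectors of finite support are dense
    (l2norm_tail), so that a bounded operator is controlled by its matrix
    (functional_eq0, adjoint_matrix, bounded_op_eval0). *)

#[local] Existing Instance totally_filter.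

(** * The norm of square-summable families *)

Lemma ler_sum_fsubset (R : numDomainType) (I : choiceType) (F F' : {fset I})
    (h : I -> R) : (forall i, 0 <= h i) -> (F `<=` F')%fset ->
  \sum_(i <- F) h i <= \sum_(i <- F') h i.
Proof.
move=> h0 FF'; pose h' i := if i \in F then h i else 0.
rewrite (eq_big_seq h') => [|i iF]; last by rewrite /h' iF.
rewrite (big_fset_incl _ FF') => [|i _ /negPf iF]; last by rewrite /h' iF.
by apply: ler_sum => i _; rewrite /h'; case: ifP.
Qed.

Section Norm.
Variables (R : realType) (I : choiceType).
Local Notation H := (ell2 R I).
Implicit Types (f g : H) (i : I) (F : {fset I}).

Lemma ell2P f g : (forall i, f i = g i) -> f = g.
Proof. by move=> fg; apply/val_inj/funext. Qed.

Lemma ell2D f g i : (f + g) i = f i + g i. Proof. by []. Qed.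
Lemma ell2N f i : (- f) i = - f i. Proof. by []. Qed.
Lemma ell2Z c f i : (c *: f) i = c * f i. Proof. by []. Qed.

Lemma ell2_sum (J : Type) (s : seq J) (P : pred J) (h : J -> H) i :
  (\sum_(j <- s | P j) h j) i = \sum_(j <- s | P j) h j i.
Proof. by apply: (big_morph (fun f : H => f i)). Qed.

Lemma deltaE (j i : I) : (delta j : H) i = (i == j)%:R.
Proof. by []. Qed.

Lemma sqsum_fin f : sqsum f \is a fin_num.
Proof. by rewrite ge0_fin_numE ?sqsum_ge0//; exact: asboolW (valP f). Qed.

Lemma l2norm_ge0 f : 0 <= l2norm f. Proof. exact: sqrtr_ge0. Qed.

Lemma sqr_l2norm f : (l2norm f ^+ 2)%:E = sqsum f.
Proof.
by rewrite sqr_sqrtr ?fineK ?sqsum_fin// fine_ge0 ?sqsum_ge0.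
Qed.

Lemma sum_sqr_le_l2norm f F :
  \sum_(i <- F) normc (f i) ^+ 2 <= l2norm f ^+ 2.
Proof.
rewrite -lee_fin sqr_l2norm; apply: esum_ge; exists [set` F]; first by split.
by rewrite fsbig_finite//= set_fsetK sumEFin lexx.
Qed.

Lemma sqsum_le (h : I -> R[i]) (M : R) :
  (forall F, \sum_(i <- F) normc (h i) ^+ 2 <= M) -> (sqsum h <= M%:E)%E.
Proof.
move=> hM; apply: ge_ereal_sup => _ [X [finX _] <-].
by rewrite fsbig_finite//= sumEFin lee_fin.
Qed.

Lemma l2norm_le f (M : R) : 0 <= M ->
  (forall F, \sum_(i <- F) normc (f i) ^+ 2 <= M ^+ 2) -> l2norm f <= M.
Proof.
move=> M0 /sqsum_le; rewrite -sqr_l2norm lee_fin => h.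
by rewrite -ler_sqr ?nnegrE ?l2norm_ge0.
Qed.

Lemma normc_le_l2norm f i : normc (f i) <= l2norm f.
Proof.
have := sum_sqr_le_l2norm f [fset i]%fset.
by rewrite big_seq_fset1 ler_sqr ?nnegrE ?normc_nneg ?l2norm_ge0.
Qed.

Lemma l2norm_eq0 f : l2norm f = 0 -> f = 0.
Proof.
move=> f0; apply: ell2P => i; apply: ComplexField.Normc.eq0_normc.
by apply/le_anti; rewrite normc_nneg -f0 normc_le_l2norm.
Qed.

Lemma sum_sqr_dom (h : I -> R[i]) f (c : R) F :
  (forall i, normc (h i) <= c * normc (f i)) ->
  \sum_(i <- F) normc (h i) ^+ 2 <= (c * l2norm f) ^+ 2.
Proof.
move=> hf; rewrite exprMn.
apply: le_trans (ler_wpM2l (sqr_ge0 c) (sum_sqr_le_l2norm f F)).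
rewrite mulr_sumr; apply: ler_sum => i _; rewrite -exprMn.
by rewrite ler_sqr ?nnegrE ?normc_nneg// (le_trans _ (hf i))// normc_nneg.
Qed.

Lemma ell2_dom (h : I -> R[i]) f (c : R) :
  (forall i, normc (h i) <= c * normc (f i)) -> h \in @ell2_pred R I.
Proof.
move=> hf; apply/asboolP.
by apply: (le_lt_trans (sqsum_le (fun F => sum_sqr_dom F hf))); exact: ltry.
Qed.

Lemma l2norm_dom f g (c : R) : 0 <= c ->
  (forall i, normc (g i) <= c * normc (f i)) -> l2norm g <= c * l2norm f.
Proof.
move=> c0 gf; apply: l2norm_le => [|F]; first by rewrite mulr_ge0 ?l2norm_ge0.
exact: sum_sqr_dom.
Qed.

(** Summing the inequality 2 a b x y <= b^2 x^2 + a^2 y^2, where a and b are the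
    norms of f and g. *)
Lemma cauchy_schwarz_fset f g F :
  \sum_(i <- F) normc (f i) * normc (g i) <= l2norm f * l2norm g.
Proof.
have [f0|f0] := eqVneq (l2norm f) 0.
  rewrite f0 mul0r big1// => i _.
  by rewrite (l2norm_eq0 f0) ComplexField.Normc.normc0 mul0r.
have [g0|g0] := eqVneq (l2norm g) 0.
  rewrite g0 mulr0 big1// => i _.
  by rewrite (l2norm_eq0 g0) ComplexField.Normc.normc0 mulr0.
have fg0 : 0 < 2 * (l2norm f * l2norm g).
  by rewrite !mulr_gt0// lt_neqAle l2norm_ge0 eq_sym ?f0 ?g0.
rewrite -(ler_pM2l fg0) mulr_sumr.
apply: (@le_trans _ _ (\sum_(i <- F) (l2norm g ^+ 2 * normc (f i) ^+ 2 +
                                      l2norm f ^+ 2 * normc (g i) ^+ 2))).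
  apply: ler_sum => i _; rewrite -subr_ge0.
  rewrite [leRHS](_ : _ = (l2norm g * normc (f i) - l2norm f * normc (g i)) ^+ 2).
    exact: sqr_ge0.
  by ring.
rewrite big_split/= -!mulr_sumr.
have := ler_wpM2l (sqr_ge0 (l2norm g)) (sum_sqr_le_l2norm f F).
have := ler_wpM2l (sqr_ge0 (l2norm f)) (sum_sqr_le_l2norm g F).
move: (\sum_(i <- F) _) (\sum_(i <- F) _) => x y hx hy.
apply: le_trans (lerD hy hx) _; rewrite le_eqVlt; apply/orP; left; apply/eqP.
by ring.
Qed.

Lemma l2normD f g : l2norm (f + g) <= l2norm f + l2norm g.
Proof.
apply: l2norm_le => [|F]; first by rewrite addr_ge0 ?l2norm_ge0.
apply: (@le_trans _ _ (\sum_(i <- F) (normc (f i) ^+ 2 +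
   normc (f i) * normc (g i) *+ 2 + normc (g i) ^+ 2))).
  apply: ler_sum => i _; rewrite -sqrrD ler_sqr ?nnegrE ?addr_ge0 ?normc_nneg//.
  exact: le_normcD.
rewrite big_split/= sqrrD lerD ?sum_sqr_le_l2norm//.
rewrite big_split/= lerD ?sum_sqr_le_l2norm// sumrMnl lerMn2r.
by rewrite cauchy_schwarz_fset orbT.
Qed.

Lemma l2normZ (c : R[i]) f : l2norm (c *: f) <= normc c * l2norm f.
Proof.
apply: l2norm_dom => [|i]; first exact: normc_nneg.
by rewrite ell2Z ComplexField.Normc.normcM.
Qed.

Lemma l2normN f : l2norm (- f) = l2norm f.
Proof.
have le (h : H) : l2norm (- h) <= l2norm h.
  have := @l2norm_dom h (- h) 1 ler01; rewrite mul1r; apply => i.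
  by rewrite ell2N normcN mul1r.
by apply/le_anti; rewrite le -{1}(opprK f) le.
Qed.

Lemma l2normB f g : l2norm (f - g) <= l2norm f + l2norm g.
Proof. by rewrite -(l2normN g) l2normD. Qed.

Lemma l2norm_delta_le i : l2norm (delta i : H) <= 1.
Proof.
apply: l2norm_le => // F; rewrite expr1n; have [iF|iF] := boolP (i \in F).
  rewrite (big_fsetD1 i)//= eqxx ComplexField.Normc.normc1 expr1n.
  rewrite big_seq big1 ?addr0// => j; rewrite in_fsetD1 => /andP[/negPf ji _].
  by rewrite ji ComplexField.Normc.normc0 expr0n.
rewrite big_seq big1// => j jF; have [ji|ji] := eqVneq j i.
  by rewrite -ji jF in iF.
by rewrite deltaE (negPf ji) ComplexField.Normc.normc0 expr0n.
Qed.

Definition truncation f F : H := \sum_(i <- F) f i *: delta i.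

Lemma truncationE f F i : truncation f F i = if i \in F then f i else 0.
Proof.
rewrite ell2_sum; case: ifPn => iF.
  rewrite (big_fsetD1 i)// ell2Z deltaE eqxx mulr1.
  rewrite big_seq big1 ?Monoid.mulm1// => j.
  rewrite in_fsetD1 => /andP[/negPf ji _].
  by rewrite ell2Z deltaE eq_sym ji mulr0.
rewrite big_seq big1// => j jF; have [ij|ij] := eqVneq i j.
  by rewrite -ij (negPf iF) in jF.
by rewrite ell2Z deltaE (negPf ij) mulr0.
Qed.

(** A finite sum within e^2 of the supremum defining the squared norm leaves
    less than e^2 for the terms outside it. *)
Lemma l2norm_tail f (e : R) : 0 < e ->
  exists F0, forall F, (F0 `<=` F)%fset -> l2norm (f - truncation f F) <= e.
Proof.
move=> e0; have e20 : 0 < e ^+ 2 by rewrite exprn_gt0.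
have : (sqsum f - (e ^+ 2)%:E < sqsum f)%E.
  by rewrite -(fineK (sqsum_fin f)) -EFinB lte_fin gtrBl.
rewrite {2}/sqsum => /ereal_sup_gt[_ [X [finX _] <-]].
rewrite fsbig_finite//= sumEFin -sqr_l2norm -EFinB lte_fin.
set F0 := fset_set X => hF0; exists F0 => F F0F.
apply: l2norm_le => [|F']; first exact: ltW.
pose F0F' := (F0 `|` F')%fset.
pose n i := normc (f i) ^+ 2; have n0 i : 0 <= n i by exact: sqr_ge0.
pose a i := if i \in F0 then n i else 0.
pose b i := if i \in F then 0 else n i.
have b0 i : 0 <= b i by rewrite /b; case: ifP.
rewrite (_ : \sum_(i <- F') _ = \sum_(i <- F') b i); last first.
  apply: eq_bigr => i _; rewrite ell2D ell2N truncationE /b.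
  by case: ifP; rewrite ?subr0// subrr ComplexField.Normc.normc0 expr0n.
have aE : \sum_(i <- F0) n i = \sum_(i <- F0F') a i.
  rewrite -(big_fset_incl _ (fsubsetUl F0 F')).
    by apply: eq_big_seq => i iF; rewrite /a iF.
  by move=> i _ /negPf iF; rewrite /a iF.
have bE : \sum_(i <- F') b i <= \sum_(i <- F0F') b i.
  by apply: ler_sum_fsubset => //; exact: fsubsetUr.
have ab : \sum_(i <- F0F') (a i + b i) <= l2norm f ^+ 2.
  apply: le_trans (sum_sqr_le_l2norm f F0F').
  apply: ler_sum => i _; rewrite /a /b; case: ifP => iF0.
    by rewrite (fsubsetP F0F _ iF0) addr0.
  by case: ifP; rewrite add0r ?n0 ?lexx.
move: ab hF0; rewrite big_split/= -aE.
by move: bE; rewrite -/n; lra.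
Qed.

End Norm.

(** * The inner product *)

Section Inner.
Variables (R : realType) (I : choiceType).
Local Notation H := (ell2 R I).
Implicit Types (f g : H) (i : I) (F : {fset I}).

Lemma near_totally (P : set {fset I}) (F0 : {fset I}) :
  (forall F, (F0 `<=` F)%fset -> P F) -> \forall F \near totally, P F.
Proof. by move=> h; exists F0. Qed.

Lemma norm_normc (z : R[i]^o) : `|z| = (normc z)%:C.
Proof. by case: z => a b; exact: normc_def. Qed.

(** The inner product is a limit in the complex numbers as a normed space over
    themselves; the radii of its balls are complex too, and this lemma trades
    them for real ones. *)
Lemma cvg_normcP (T : Type) (G : set_system T) {FG : Filter G}
    (u : T -> R[i]^o) (l : R[i]^o) :
  (u @ G --> l) <->
  forall e : R, 0 < e -> \forall x \near G, normc (l - u x) < e.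
Proof.
split=> [/(@cvgrPdist_lt R[i] R[i]^o) ul e e0|ul].
  have /ul : 0 < e%:C by rewrite ltcR.
  by apply: filterS => x; rewrite norm_normc ltcR.
apply/(@cvgrPdist_lt R[i] R[i]^o) => e; rewrite ltcE /= => /andP[/eqP e0 /ul].
by apply: filterS => x; rewrite norm_normc ltcE /= e0 eqxx.
Qed.

Lemma nonneg_sum_cvg (b : I -> R) (M : R) : (forall i, 0 <= b i) ->
  (forall F, \sum_(i <- F) b i <= M) ->
  cvg ((fun F => \sum_(i <- F) b i) @ totally).
Proof.
move=> b0 bM; pose S F := \sum_(i <- F) b i; apply/cvg_ex.
have supS : has_sup (range S).
  split; first by exists (S fset0); exists fset0.
  by exists M => _ [F _ <-]; exact: bM.
exists (sup (range S)); apply/cvgrPdist_lt => e e0.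
have [_ [F0 _ <-] hF0] := sup_adherent e0 supS.
apply: (@near_totally _ F0) => F F0F.
have F0FS : S F0 <= S F by exact: ler_sum_fsubset.
rewrite ger0_norm ?subr_ge0; first by rewrite ltrBlDl -ltrBlDr (lt_le_trans hF0).
by apply: ub_le_sup; [case: supS|exists F].
Qed.

(** b is the difference of the nonnegative families b + |b| and |b|. *)
Lemma abs_sum_cvg (b : I -> R) (M : R) :
  (forall F, \sum_(i <- F) `|b i| <= M) ->
  cvg ((fun F => \sum_(i <- F) b i) @ totally).
Proof.
move=> bM.
have c1 : cvg ((fun F => \sum_(i <- F) `|b i|) @ totally).
  exact: nonneg_sum_cvg bM.
have c2 : cvg ((fun F => \sum_(i <- F) (b i + `|b i|)) @ totally).
  apply: (@nonneg_sum_cvg _ (M + M)) => [i|F].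
    by rewrite -lerBlDl sub0r -normrN ler_norm.
  rewrite big_split/= lerD// (le_trans _ (bM F))//.
  by apply: ler_sum => i _; exact: ler_norm.
rewrite (_ : (fun F => _) = (fun F => \sum_(i <- F) (b i + `|b i|)) \-
                            (fun F => \sum_(i <- F) `|b i|)).
  exact: is_cvgB.
by apply/funext => F /=; rewrite big_split/= addrK.
Qed.

Lemma Re_normc (z : R[i]) : `|complex.Re z| <= normc z.
Proof.
by case: z => a b /=; rewrite -sqrtr_sqr ler_wsqrtr// lerDl sqr_ge0.
Qed.

Lemma Im_normc (z : R[i]) : `|complex.Im z| <= normc z.
Proof.
by case: z => a b /=; rewrite -sqrtr_sqr ler_wsqrtr// lerDr sqr_ge0.
Qed.

Lemma normc_ReIm (z : R[i]) : normc z <= `|complex.Re z| + `|complex.Im z|.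
Proof.
case: z => a b /=; rewrite -(@ger0_norm _ (`|a| + `|b|)) ?addr_ge0//.
rewrite -sqrtr_sqr ler_wsqrtr// sqrrD !real_normK ?num_real//.
by rewrite -addrA lerD2l lerDr mulrn_wge0// mulr_ge0.
Qed.

Lemma Re_sum (x : I -> R[i]) F :
  complex.Re (\sum_(i <- F) x i) = \sum_(i <- F) complex.Re (x i).
Proof. by apply: (big_morph (@complex.Re R)) => // -[? ?] [? ?]. Qed.

Lemma Im_sum (x : I -> R[i]) F :
  complex.Im (\sum_(i <- F) x i) = \sum_(i <- F) complex.Im (x i).
Proof. by apply: (big_morph (@complex.Im R)) => // -[? ?] [? ?]. Qed.

Lemma normc_sum_cvg (x : I -> R[i]) (M : R) :
  (forall F, \sum_(i <- F) normc (x i) <= M) ->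
  exists l : R[i],
    (fun F => \sum_(i <- F) x i : R[i]^o) @ totally --> (l : R[i]^o).
Proof.
move=> xM.
have /cvg_ex[a /cvgrPdist_lt ha] :
    cvg ((fun F => \sum_(i <- F) complex.Re (x i)) @ totally).
  apply: (@abs_sum_cvg _ M) => F; apply: le_trans (xM F).
  by apply: ler_sum => i _; exact: Re_normc.
have /cvg_ex[b /cvgrPdist_lt hb] :
    cvg ((fun F => \sum_(i <- F) complex.Im (x i)) @ totally).
  apply: (@abs_sum_cvg _ M) => F; apply: le_trans (xM F).
  by apply: ler_sum => i _; exact: Im_normc.
exists (a +i* b); apply/cvg_normcP => e e0.
have e20 : 0 < e / 2 by rewrite divr_gt0.
near=> F; apply: le_lt_trans (normc_ReIm _) _; rewrite (splitr e) ltrD//.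
  rewrite (_ : complex.Re _ = a - \sum_(i <- F) complex.Re (x i)).
    by near: F; exact: ha.
  by rewrite -Re_sum; case: (\sum_(i <- F) x i).
rewrite (_ : complex.Im _ = b - \sum_(i <- F) complex.Im (x i)).
  by near: F; exact: hb.
by rewrite -Im_sum; case: (\sum_(i <- F) x i).
Unshelve. all: by end_near. Qed.

Lemma normcJ (z : R[i]) : normc (conjc z) = normc z.
Proof. by case: z => a b /=; rewrite sqrrN. Qed.

Local Notation term f g := (fun i => f i * conjc (g i) : R[i]^o).

Lemma sum_normc_le f g F :
  \sum_(i <- F) normc (term f g i) <= l2norm f * l2norm g.
Proof.
apply: le_trans (cauchy_schwarz_fset f g F); apply: ler_sum => i _.
by rewrite ComplexField.Normc.normcM normcJ.
Qed.

Lemma inner_lim f g (l : R[i]^o) :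
  (fun F => \sum_(i <- F) term f g i) @ totally --> l -> inner f g = l.
Proof.
move=> fgl; rewrite /inner /summability.sum.
apply: (@cvg_lim R[i]^o); first exact: norm_hausdorff.
rewrite (_ : partial_sum _ = fun F => \sum_(i <- F) term f g i)//.
by apply/funext => F; rewrite /partial_sum big_seq_fsetE.
Qed.

Lemma inner_cvg f g :
  (fun F => \sum_(i <- F) term f g i) @ totally --> (inner f g : R[i]^o).
Proof.
by have [l fgl] := normc_sum_cvg (sum_normc_le f g); rewrite (inner_lim fgl).
Qed.

Lemma innerDl f f' g : inner (f + f') g = inner f g + inner f' g.
Proof.
apply: inner_lim; rewrite (_ : (fun F => _) =
    (fun F => \sum_(i <- F) term f g i) \+
    (fun F => \sum_(i <- F) term f' g i)).
  by apply: (@cvgD R[i] R[i]^o); exact: inner_cvg.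
apply/funext => F; rewrite /= -big_split; apply: eq_bigr => i _.
by rewrite mulrDl.
Qed.

Lemma innerDr f g g' : inner f (g + g') = inner f g + inner f g'.
Proof.
apply: inner_lim; rewrite (_ : (fun F => _) =
    (fun F => \sum_(i <- F) term f g i) \+
    (fun F => \sum_(i <- F) term f g' i)).
  by apply: (@cvgD R[i] R[i]^o); exact: inner_cvg.
apply/funext => F; rewrite /= -big_split; apply: eq_bigr => i _.
by rewrite /= rmorphD mulrDr.
Qed.

Lemma inner_support1 f g i :
  (forall j, j != i -> f j * conjc (g j) = 0) -> inner f g = f i * conjc (g i).
Proof.
move=> fg0; apply: inner_lim; apply: cvg_near_cst.
apply: (@near_totally _ [fset i]%fset) => F /fsubsetP /(_ i) iF.
rewrite (big_fsetD1 i) ?iF ?inE// big_seq big1 ?Monoid.mulm1// => j.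
by rewrite in_fsetD1 => /andP[ji _]; rewrite fg0.
Qed.

Lemma inner_deltal (c : R[i]) i g : inner (c *: delta i) g = c * conjc (g i).
Proof.
rewrite (@inner_support1 _ _ i) => [|j /negPf ji].
  by rewrite ell2Z deltaE eqxx mulr1.
by rewrite ell2Z deltaE ji mulr0 mul0r.
Qed.

Lemma inner_deltar (c : R[i]) i f : inner f (c *: delta i) = f i * conjc c.
Proof.
rewrite (@inner_support1 _ _ i) => [|j /negPf ji].
  by rewrite ell2Z deltaE eqxx mulr1.
by rewrite ell2Z deltaE ji mulr0 rmorph0 mulr0.
Qed.

Lemma inner_bound f g : normc (inner f g) <= l2norm f * l2norm g.
Proof.
apply/ler_addgt0Pr => e e0.
have /cvg_normcP/(_ e e0) hF := inner_cvg (f := f) (g := g).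
have [F /= {}hF] := filter_ex hF.
rewrite -(subrK (\sum_(i <- F) term f g i) (inner f g)).
apply: le_trans (le_normcD _ _) _; rewrite addrC lerD ?(ltW hF)//.
apply: le_trans (sum_normc_le f g F).
elim/big_ind2 : _ => //; first by rewrite ComplexField.Normc.normc0.
by move=> x a y b xa yb; rewrite (le_trans (le_normcD _ _))// lerD.
Qed.

(** Truncations of f are dense around f, and phi vanishes on them. Additivity
    is all that is asked of phi, so that the lemma also applies to functionals
    which are conjugate-linear. *)
Lemma functional_eq0 (phi : H -> R[i]) (M : R) f :
  {morph phi : f g / f + g} -> (forall f, normc (phi f) <= M * l2norm f) ->
  (forall i, phi (f i *: delta i) = 0) -> phi f = 0.
Proof.
move=> phiD phiM phi0.
have phi00 : phi 0 = 0 by apply: (@addrI _ (phi 0)); rewrite -phiD !addr0.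
have phiF F : phi (truncation f F) = 0.
  by rewrite (big_morph phi phiD phi00) big1.
apply: ComplexField.Normc.eq0_normc; apply/le_anti; rewrite normc_nneg andbT.
apply/ler_addgt0Pr => e e0; rewrite add0r.
have M0 : 0 < `|M| + 1 by rewrite ltr_wpDl.
have [F /(_ F (fsubset_refl F)) hF] := l2norm_tail f (divr_gt0 e0 M0).
rewrite -(subrK (truncation f F) f) phiD phiF addr0.
apply: le_trans (phiM _) _.
apply: (@le_trans _ _ ((`|M| + 1) * l2norm (f - truncation f F))).
  by rewrite ler_wpM2r ?l2norm_ge0// (le_trans (ler_norm M))// lerDl.
by rewrite mulrC -ler_pdivlMr.
Qed.

Lemma innerC f g : inner g f = conjc (inner f g).
Proof.
pose phi h := inner h f - conjc (inner f h).
apply/eqP; rewrite -subr_eq0; apply/eqP; rewrite -/(phi g).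
apply: (@functional_eq0 phi (l2norm f *+ 2)); rewrite /phi.
- by move=> h h'; rewrite innerDl innerDr rmorphD opprD addrACA.
- move=> h; apply: le_trans (le_normcD _ _) _.
  rewrite normcN normcJ mulrnAl mulr2n.
  by rewrite lerD ?inner_bound// mulrC inner_bound.
- by move=> i; rewrite inner_deltal inner_deltar rmorphM /= conjcK mulrC subrr.
Qed.

End Inner.

(** * Bounded operators *)

Section Operators.
Variables (R : realType) (I : choiceType).
Local Notation H := (ell2 R I).
Implicit Types (f g : H) (i : I) (A B C T : H -> H).

Lemma opD A B f : (A + B) f = A f + B f. Proof. by []. Qed.
Lemma opZ c A f : (c *: A) f = c *: A f. Proof. by []. Qed.

Lemma linearop0 A : linear A -> A 0 = 0.
Proof.
move=> lA; apply: (@addrI _ (A 0)).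
by rewrite -{1}(scale1r (A 0)) -lA scaler0 !addr0.
Qed.

Lemma linearopZ A : linear A -> forall c f, A (c *: f) = c *: A f.
Proof. by move=> lA c f; rewrite -[c *: f]addr0 lA (linearop0 lA) addr0. Qed.

Lemma linearopD A : linear A -> {morph A : f g / f + g}.
Proof. by move=> lA f g; rewrite -(scale1r f) lA !scale1r. Qed.

Lemma linearopB A : linear A -> {morph A : f g / f - g}.
Proof.
by move=> lA f g; rewrite (linearopD lA) -(scaleN1r g) (linearopZ lA) scaleN1r.
Qed.

Lemma linearop_sum A (J : Type) (s : seq J) (h : J -> H) : linear A ->
  A (\sum_(j <- s) h j) = \sum_(j <- s) A (h j).
Proof. by move=> lA; apply: big_morph; [exact: linearopD|exact: linearop0]. Qed.

Lemma bounded_opP A : bounded_op A ->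
  linear A /\ exists2 M, 0 <= M & forall f, l2norm (A f) <= M * l2norm f.
Proof.
move=> [lA [M AM]]; split=> //; exists `|M| => // f.
by rewrite (le_trans (AM f))// ler_wpM2r ?l2norm_ge0 ?ler_norm.
Qed.

Lemma bounded_op0 : bounded_op (0 : H -> H).
Proof.
split=> [c f g|]; first by rewrite scaler0 addr0.
exists 0 => f; rewrite mul0r; have := l2normZ 0 (0 : H).
by rewrite scale0r ComplexField.Normc.normc0 mul0r.
Qed.

Lemma bounded_opD A B : bounded_op A -> bounded_op B -> bounded_op (A + B).
Proof.
move=> [lA [M AM]] [lB [M' BM']]; split=> [c f g|].
  by rewrite !opD lA lB scalerDr addrACA.
exists (M + M') => f; rewrite mulrDl.
by rewrite (le_trans (l2normD _ _))// lerD.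
Qed.

Lemma bounded_op_id : bounded_op (idfun : H -> H).
Proof. by split=> //; exists 1 => f; rewrite mul1r. Qed.

Lemma bounded_op_comp A B : bounded_op A -> bounded_op B -> bounded_op (A \o B).
Proof.
move=> /bounded_opP[lA [M M0 AM]] /bounded_opP[lB [M' _ BM']]; split.
  by move=> c f g /=; rewrite lB lA.
exists (M * M') => f /=; rewrite (le_trans (AM _))// -mulrA.
by rewrite ler_wpM2l.
Qed.

Lemma bounded_opZ c A : bounded_op A -> bounded_op (c *: A).
Proof.
move=> [lA [M AM]]; split=> [c' f g|].
  by rewrite !opZ lA scalerDr !scalerA mulrC.
exists (normc c * M) => f; rewrite -mulrA.
by rewrite (le_trans (l2normZ _ _))// ler_wpM2l ?normc_nneg.
Qed.

(** Both sides of the adjunction are bounded and additive in each argument, so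
    it is enough to test it on basis vectors, one argument after the other. *)
Lemma adjoint_matrix A B : bounded_op A -> bounded_op B ->
  (forall i j, A (delta i) j = conjc (B (delta j) i)) -> adjoint A B.
Proof.
move=> /bounded_opP[lA [M M0 AM]] /bounded_opP[lB [M' M'0 BM']] AB f g.
pose phi g f := inner (A f) g - inner f (B g).
have phi_bound h h' : normc (phi h' h) <= (M + M') * l2norm h * l2norm h'.
  apply: le_trans (le_normcD _ _) _; rewrite normcN !mulrDl lerD//.
    by rewrite (le_trans (inner_bound _ _))// ler_wpM2r ?l2norm_ge0.
  rewrite (le_trans (inner_bound _ _))// -mulrA mulrCA.
  by rewrite ler_wpM2l ?l2norm_ge0.
have phiDl h : {morph phi h : f g / f + g}.
  by move=> h1 h2; rewrite /phi (linearopD lA) !innerDl opprD addrACA.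
have phiDr h : {morph phi^~ h : f g / f + g}.
  by move=> h1 h2; rewrite /phi (linearopD lB) !innerDr opprD addrACA.
have phi0 i h : phi (h i *: delta i) f = 0.
  apply: (@functional_eq0 _ _ (phi (h i *: delta i))
    ((M + M') * l2norm (h i *: delta i : H))) => // [h'|j].
    by rewrite mulrAC phi_bound.
  rewrite /phi (linearopZ lA) (linearopZ lB) inner_deltal inner_deltar.
  by rewrite !ell2Z AB rmorphM mulrA mulrAC subrr.
apply/eqP; rewrite -subr_eq0; apply/eqP; rewrite -/(phi g f).
exact: (@functional_eq0 _ _ (phi^~ f) ((M + M') * l2norm f)).
Qed.

Lemma adjoint_sym A B : adjoint A B -> adjoint B A.
Proof. by move=> AB f g; rewrite innerC -AB -innerC. Qed.

Lemma adjoint0 : adjoint (0 : H -> H) 0.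
Proof.
move=> f g; have -> : inner (0 : H) g = 0.
  by apply: (@addrI _ (inner 0 g)); rewrite -innerDl !addr0.
by apply: (@addrI _ (inner f 0)); rewrite -innerDr !addr0.
Qed.

Lemma adjointD A A' B B' : adjoint A B -> adjoint A' B' ->
  adjoint (A + A') (B + B').
Proof.
move=> AB A'B' f g.
by rewrite !opD innerDl innerDr AB A'B'.
Qed.

Lemma adjoint_sum (n : nat) (A B : 'I_n -> H -> H) :
  (forall k, adjoint (A k) (B k)) -> adjoint (\sum_k A k) (\sum_k B k).
Proof.
move=> AB; elim/big_rec2 : _ => [|k C C' _]; first exact: adjoint0.
exact: adjointD.
Qed.

Lemma inner_inj f g : (forall h, inner f h = inner g h) -> f = g.
Proof.
move=> fg; apply: ell2P => i; have := fg (1 *: delta i).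
by rewrite !inner_deltar rmorph1 !mulr1.
Qed.

(** The form in which supports are followed through an operator: the support
    of A f lies in the union of those of A xi_j, for j in the support of f. *)
Lemma bounded_op_eval0 A f i : bounded_op A ->
  (forall j, f j != 0 -> A (delta j) i = 0) -> A f i = 0.
Proof.
move=> /bounded_opP[lA [M M0 AM]] Af.
apply: (@functional_eq0 _ _ (fun f => A f i) M) => [h h'|h|j].
- by rewrite (linearopD lA).
- exact: le_trans (normc_le_l2norm _ _) (AM h).
- rewrite (linearopZ lA) ell2Z; have [->|/Af ->] := eqVneq (f j) 0.
    by rewrite mul0r.
  by rewrite mulr0.
Qed.

Definition partial_injection (phi : I -> option I) :=
  forall i j, phi i = phi j -> phi i <> None -> i = j.

Lemma pull_subproof phi (phiI : partial_injection phi) f :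
  (fun i => oapp f 0 (phi i)) \in @ell2_pred R I.
Proof.
by apply/asboolP; apply: le_lt_trans (sqsum_pull _ phiI) (asboolW (valP f)).
Qed.

(** Composition with phi, read as 0 where phi is undefined. Left and right
    multiplications and the projections onto coordinate subspaces are all of
    this form. *)
Definition pull phi (phiI : partial_injection phi) f : H :=
  Ell2 (pull_subproof phiI f).

Lemma pullE phi (phiI : partial_injection phi) f i :
  pull phiI f i = oapp f 0 (phi i).
Proof. by []. Qed.

Lemma bounded_pull phi (phiI : partial_injection phi) : bounded_op (pull phiI).
Proof.
split=> [c f g|].
  apply: ell2P => i; rewrite ell2D ell2Z !pullE.
  by case: (phi i) => [j|] /=; rewrite ?ell2D ?ell2Z// mulr0 addr0.
exists 1 => f; rewrite mul1r; rewrite -ler_sqr ?nnegrE ?l2norm_ge0//.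
by rewrite -lee_fin !sqr_l2norm; exact: sqsum_pull.
Qed.

Lemma adjoint_pull phi psi (phiI : partial_injection phi)
    (psiI : partial_injection psi) :
  (forall i j, phi i = Some j <-> psi j = Some i) ->
  adjoint (pull phiI) (pull psiI).
Proof.
move=> pp; apply: adjoint_matrix => [||i j]; try exact: bounded_pull.
have E k l : oapp (delta l : H) 0 k = (k == Some l)%:R by case: k.
rewrite !pullE !E conjc_nat; congr ((_ : bool)%:R).
by apply/eqP/eqP => /pp.
Qed.

Lemma is_opsum_near (J : choiceType) (a : J -> H -> H) T : is_opsum a T ->
  forall f e, 0 < e ->
  exists F : {fset J}, forall F' : {fset J}, (F `<=` F')%fset ->
    l2norm (T f - \sum_(j <- F') a j f) < e.
Proof.
move=> [_ aT] f e e0; have /cvgr0Pnorm_lt/(_ e e0)[F _ hF] := aT f.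
by exists F => F' /hF /=; rewrite ger0_norm ?l2norm_ge0.
Qed.

Lemma is_opsum_commute (J : choiceType) (a : J -> H -> H) T C :
  bounded_op C -> is_opsum a T -> (forall j, C \o a j = a j \o C) ->
  C \o T = T \o C.
Proof.
move=> /bounded_opP[lC [M M0 CM]] aT Ca; apply/funext => f /=.
apply/eqP; rewrite -subr_eq0; apply/eqP/l2norm_eq0/le_anti.
rewrite l2norm_ge0 andbT; apply/ler_addgt0Pr => e e0; rewrite add0r.
have e1 : 0 < e / (M + 1) by rewrite divr_gt0// ltr_wpDl.
have [F1 h1] := is_opsum_near aT f e1.
have [F2 h2] := is_opsum_near aT (C f) e1.
have {}h1 := ltW (h1 _ (fsubsetUl F1 F2)).
have {}h2 := ltW (h2 _ (fsubsetUr F1 F2)).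
move: (F1 `|` F2)%fset h1 h2 => F h1 h2.
set S := \sum_(j <- F) a j f in h1.
have CS : C S = \sum_(j <- F) a j (C f).
  rewrite (linearop_sum _ _ lC); apply: eq_bigr => j _.
  exact: (congr1 (@^~ f) (Ca j)).
rewrite (_ : C (T f) - T (C f) = C (T f - S) - (T (C f) - C S)); last first.
  by rewrite (linearopB lC) opprB addrA subrK.
rewrite -CS in h2; apply: le_trans (l2normB _ _) _.
have h3 := le_trans (CM _) (ler_wpM2l M0 h1).
apply: le_trans (lerD h3 h2) _.
by rewrite -{2}(mul1r (e / _)) -mulrDl mulrC divfK// gt_eqF// ltr_wpDl.
Qed.

End Operators.

(** * Von Neumann algebras *)

Section VonNeumann.
Variables (R : realType) (I : choiceType).
Local Notation H := (ell2 R I).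
Implicit Types (X M : set (H -> H)) (A B C T : H -> H) (f : H).

Lemma commutant_bounded X A : commutant X A -> bounded_op A.
Proof. by case. Qed.

Lemma commutantE X A C f : commutant X A -> X C -> A (C f) = C (A f).
Proof. by move=> [_ AX] /AX /(congr1 (@^~ f)). Qed.

Lemma commutantD X A B : (forall C, X C -> linear C) ->
  commutant X A -> commutant X B -> commutant X (A + B).
Proof.
move=> lX AX BX; split=> [|C XC]; first by apply: bounded_opD; [case: AX|case: BX].
apply/funext => f /=; have lC := lX _ XC.
by rewrite !opD (linearopD lC) (commutantE _ AX)// (commutantE _ BX).
Qed.

Lemma commutantZ X c A : (forall C, X C -> linear C) ->
  commutant X A -> commutant X (c *: A).
Proof.
move=> lX AX; split=> [|C XC]; first by apply: bounded_opZ; case: AX.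
apply/funext => f /=; have lC := lX _ XC.
by rewrite !opZ (linearopZ lC) (commutantE _ AX).
Qed.

Lemma commutant_opsum X (J : choiceType) (a : J -> H -> H) T :
  (forall C, X C -> bounded_op C) -> (forall j, commutant X (a j)) ->
  is_opsum a T -> commutant X T.
Proof.
move=> bX aX aT; split=> [|C XC]; first by case: aT.
by rewrite (is_opsum_commute (bX _ XC) aT)// => j; have [_ ->] := aX j.
Qed.

Lemma vN_algebraE M : vN_algebra M -> M = commutant (commutant M).
Proof. by case. Qed.

Lemma vN_algebra0 M : vN_algebra M -> M 0.
Proof.
move=> /vN_algebraE ->; split=> [|C [[lC _] _]]; first exact: bounded_op0.
by apply/funext => f /=; rewrite (linearop0 lC).
Qed.

Lemma vN_algebraD M A B : vN_algebra M -> M A -> M B -> M (A + B).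
Proof.
move=> /vN_algebraE ->; apply: commutantD => C.
by case/commutant_bounded.
Qed.

Lemma vN_algebraZ M c A : vN_algebra M -> M A -> M (c *: A).
Proof.
move=> /vN_algebraE ->; apply: commutantZ => C.
by case/commutant_bounded.
Qed.

Lemma vN_algebra_opsum M (J : choiceType) (a : J -> H -> H) T :
  vN_algebra M -> (forall j, M (a j)) -> is_opsum a T -> M T.
Proof.
move=> /vN_algebraE ->; apply: commutant_opsum => C.
exact: commutant_bounded.
Qed.

Lemma vN_gen_le X M : vN_algebra M -> X `<=` M -> vN_gen X `<=` M.
Proof. by move=> vM XM T; apply. Qed.

Lemma sub_vN_gen X : X `<=` vN_gen X.
Proof. by move=> T XT M [_]; apply. Qed.

(** Closure under adjoints: if B is adjoint to A and C' to C, then B commutes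
    with C because A commutes with C'. *)
Lemma vN_algebra_commutant X : (forall C, X C -> bounded_op C) ->
  (forall C, X C -> exists2 C', X C' & adjoint C C') ->
  vN_algebra (commutant X).
Proof.
move=> bX Xadj; split=> [A B [bA AX] bB AB|].
  split=> // C XC; have [C' XC' CC'] := Xadj _ XC.
  have E h : A (C' h) = C' (A h) by exact: (congr1 (@^~ h) (AX _ XC')).
  have BA := adjoint_sym AB.
  by apply/funext => f /=; apply: inner_inj => h; rewrite BA CC' -E -BA -CC'.
apply/seteqP; split=> [A [bA AX]|A [bA AX]]; split=> // C.
  move=> XC; apply: AX; split=> [|B [bB BX]]; first exact: bX.
  by rewrite BX.
by move=> [bC CX]; rewrite CX.
Qed.

End VonNeumann.

(** * The graph groupoid *)

Section GroupoidTheory.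
Variable G : digraph.
Implicit Types (u w x y : rpath G) (a b : option (rpath G)) (e : sedge G).
Implicit Types (p q : seq (sedge G)) (c : pred (sedge G)).

Lemma gmul_None u w : rend u <> rstart w -> gmul (Some u) (Some w) = None.
Proof. by move=> /eqP /negPf /= ->. Qed.

Lemma gmul_Some u w x : gmul (Some u) (Some w) = Some x ->
  [/\ rend u = rstart w, rstart x = rstart u, rend x = rend w &
      rword x = reduce (rword u ++ rword w)].
Proof.
have [uw|/eqP uw] := eqVneq (rend u) (rstart w); last by rewrite gmul_None.
by have [x' [-> ? ? ?]] := gmulE uw => -[<-].
Qed.

Lemma gmulA : associative (@gmul G).
Proof.
case=> [u|] [w|] [x|] //; last by case: (gmul (Some u) (Some w)).
have [uw|/eqP uw] := eqVneq (rend u) (rstart w); last first.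
  rewrite (gmul_None uw); case wx: (gmul (Some w) (Some x)) => [y|//].
  by have [_ yw _ _] := gmul_Some wx; rewrite gmul_None ?yw.
have [uw' [uwE suw euw wuw]] := gmulE uw; rewrite uwE.
have [wx|/eqP wx] := eqVneq (rend w) (rstart x); last first.
  by rewrite (gmul_None wx) gmul_None// euw.
have [wx' [wxE swx ewx wwx]] := gmulE wx; rewrite wxE.
have [|l [-> sl el wl]] := @gmulE _ u wx'; first by rewrite swx.
have [|r [-> sr er wr]] := @gmulE _ uw' x; first by rewrite euw.
congr Some; apply: rpath_inj; first by rewrite sl sr.
rewrite wl wr wuw wwx [LHS]reduce_cat reduce_id ?reduce_reduced//.
rewrite reduce_cat [RHS]reduce_cat foldr_reduce ?reduce_reduced//.
by rewrite foldr_cat.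
Qed.

Lemma gmul_vertl w : gmul (Some (rvert (rstart w))) (Some w) = Some w.
Proof.
have [//|x [-> sx _ wx]] := @gmulE _ (rvert (rstart w)) w.
by congr Some; apply: rpath_inj; rewrite ?sx// wx reduce_id ?(rpathP w).2.
Qed.

Lemma gmul_vertr w : gmul (Some w) (Some (rvert (rend w))) = Some w.
Proof.
have [//|x [-> sx _ wx]] := @gmulE _ w (rvert (rend w)).
by congr Some; apply: rpath_inj; rewrite ?sx// wx cats0 reduce_id ?(rpathP w).2.
Qed.

Definition rinv w : rpath G := @RPath G (_, _) (ginv_subproof w).

Lemma ginv_Some w : ginv (Some w) = Some (rinv w). Proof. by []. Qed.

Lemma rinvK : involutive rinv.
Proof. by move=> w; apply: Some_inj; rewrite -!ginv_Some ginvK. Qed.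

Lemma rend_rinv w : rend (rinv w) = rstart w.
Proof. by apply: endpoint_rev; have [] := rpathP w. Qed.

Lemma rword_rinv w : rword (rinv w) = winv (rword w). Proof. by []. Qed.

Lemma rinv_edge e : rinv (redge e) = redge (sinv e).
Proof. by apply: rpath_inj; rewrite // /rstart /= /rend /= ssrc_inv. Qed.

Lemma rinv_vert v : rinv (rvert v) = rvert v.
Proof. exact: rpath_inj. Qed.

Lemma gmulKr w u x :
  gmul (Some u) (Some (rinv w)) = Some x <-> gmul (Some x) (Some w) = Some u.
Proof.
by split=> h; apply: gmulK => //; rewrite ?ginv_Some ?rinvK.
Qed.

Lemma gmul_rinv w : gmul (Some w) (Some (rinv w)) = Some (rvert (rstart w)).
Proof. by apply/gmulKr; rewrite gmul_vertl. Qed.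

Lemma gmulKl w u x :
  gmul (Some (rinv w)) (Some u) = Some x <-> gmul (Some w) (Some x) = Some u.
Proof.
have K w' u' x' : gmul (Some (rinv w')) (Some u') = Some x' ->
    gmul (Some w') (Some x') = Some u'.
  move=> h; rewrite -h gmulA gmul_rinv.
  by have [+ _ _ _] := gmul_Some h; rewrite rend_rinv => ->; exact: gmul_vertl.
by split=> [|h]; [exact: K|apply: K; rewrite rinvK].
Qed.

Lemma all_reduce c p : all c p -> all c (reduce p).
Proof.
elim: p => //= e p IHp /andP[ce /IHp]; rewrite -/(reduce p).
case: (reduce p) => [|f q] /=; first by rewrite ce.
by case: ifP => _ /=; rewrite ?ce//= => /andP[].
Qed.

Lemma all_gmul c u w x : gmul (Some u) (Some w) = Some x ->
  all c (rword u) -> all c (rword w) -> all c (rword x).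
Proof.
by move=> /gmul_Some[_ _ _ ->] cu cw; rewrite all_reduce// all_cat cu.
Qed.

Lemma all_rinv c w : {mono @sinv G : e / c e} ->
  all c (rword (rinv w)) = all c (rword w).
Proof.
by move=> cV; rewrite rword_rinv /winv all_rev all_map; apply: eq_all => e /=.
Qed.

Definition ends_in c w : bool :=
  if rword w is e :: p then c (last e p) else false.

(** If an edge f of colour c could cancel an edge e, then f = e^-1 and e would
    have colour c too; hence the product is the concatenation of the words. *)
Lemma ends_in_gmul c u w x : {mono @sinv G : e / c e} ->
  gmul (Some u) (Some w) = Some x -> ~~ ends_in c u ->
  all c (rword w) -> rword w <> [::] -> ends_in c x.
Proof.
move=> cV /gmul_Some[_ _ _ xE]; have [_ ru] := rpathP u; have [_ rw] := rpathP w.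
rewrite /ends_in xE; move: (rword u) (rword w) ru rw {xE} => p [|f q]// rp rq.
move=> cp cq _; rewrite reduce_id; last first.
  case: p rp cp => [//|e p] /= rp cp; rewrite /reduced /= cat_path.
  rewrite -/(reduced _) in rq *; apply/and3P; split=> //.
  apply: contra cp => /eqP fE; move: cq => /= /andP[+ _].
  by rewrite fE cV.
have cl : c (last f q) by move: cq => /allP; apply; rewrite mem_last.
by case: p {rp cp} => [|e p] //=; rewrite last_cat.
Qed.

End GroupoidTheory.

(** * Left multiplications and colour projections *)

Section Multiplications.
Variables (R : realType) (G : digraph).
Local Notation H := (ell2 R (rpath G)).
Implicit Types (f : H) (u w x y : rpath G) (e : sedge G) (c : pred (sedge G)).

Lemma bounded_rmul a : bounded_op (@rmul R G a).
Proof.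
have phiI : partial_injection (fun u => gmul (Some u) (ginv a)).
  move=> i j ij iN; have aN : a <> None by move=> a0; move: iN; rewrite a0.
  by have := gmulK aN iN (esym ij); rewrite (gmulK aN iN (erefl _)) => -[].
rewrite (_ : rmul a = pull phiI); first exact: bounded_pull.
by apply/funext => f; apply: ell2P.
Qed.

Lemma rmulE w f u :
  rmul (Some w) f u = oapp f 0 (gmul (Some u) (Some (rinv w))).
Proof. by []. Qed.

Lemma rmul_vertE v f w :
  rmul (Some (rvert v)) f w = if rend w == v then f w else 0.
Proof.
rewrite rmulE rinv_vert; case: eqP => [<-|wv]; first by rewrite gmul_vertr.
by rewrite gmul_None.
Qed.

Lemma lmul_partial_injection w :
  partial_injection (fun u => gmul (Some (rinv w)) (Some u)).
Proof.
move=> i j ij; case E : (gmul _ (Some i)) ij => [x|//] ij _.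
move/gmulKl: E; have /gmulKl -> := esym ij; by case.
Qed.

Definition lmul w : H -> H := pull (@lmul_partial_injection w).

Lemma lmulE w f u :
  lmul w f u = oapp f 0 (gmul (Some (rinv w)) (Some u)).
Proof. by []. Qed.

Lemma adjoint_lmul w : adjoint (lmul w) (lmul (rinv w)).
Proof. by apply: adjoint_pull => u x; rewrite rinvK; exact: gmulKl. Qed.

Lemma lmul_delta w : lmul w (delta (rvert (rend w))) = delta w.
Proof.
apply: ell2P => x; rewrite lmulE deltaE.
case E: (gmul _ _) => [y|] /=; last first.
  case: eqP => // xw; move: E; rewrite xw.
  by have /gmulKl -> := gmul_vertr w.
congr ((_ : bool)%:R); apply/eqP/eqP => [yE|xE].
  by move/gmulKl: E; rewrite yE gmul_vertr => -[].
by move: E; rewrite xE; have /gmulKl -> := gmul_vertr w => -[].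
Qed.

Lemma rmul_lmul a w : rmul a \o lmul w = lmul w \o @rmul R G a.
Proof.
apply/funext => f; apply: ell2P => u /=.
change (oapp (lmul w f) 0 (gmul (Some u) (ginv a)) =
        oapp (rmul a f) 0 (gmul (Some (rinv w)) (Some u))).
have -> : oapp (lmul w f) 0 (gmul (Some u) (ginv a)) =
    oapp f 0 (gmul (Some (rinv w)) (gmul (Some u) (ginv a))).
  by case: (gmul (Some u) _).
by rewrite gmulA; case: (gmul (Some _) (Some u)).
Qed.

Definition monochromatic c u : option (rpath G) :=
  if all c (rword u) then Some u else None.

Lemma monochromatic_injection c : partial_injection (monochromatic c).
Proof.
by move=> i j; rewrite /monochromatic; case: ifP => // _; case: ifP => // _ [].
Qed.

Definition cproj c : H -> H := pull (@monochromatic_injection c).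

Lemma cprojE c f u : cproj c f u = if all c (rword u) then f u else 0.
Proof. by rewrite /cproj pullE /monochromatic; case: ifP. Qed.

Lemma adjoint_cproj c : adjoint (cproj c) (cproj c).
Proof.
apply: adjoint_pull => i j; rewrite /monochromatic.
by split; case: ifP => // ci [<-]; rewrite ci.
Qed.

Lemma rmul_cproj c w : {mono @sinv G : e / c e} -> all c (rword w) ->
  rmul (Some w) \o cproj c = cproj c \o @rmul R G (Some w).
Proof.
move=> cV cw; apply/funext => f; apply: ell2P => u.
change (rmul (Some w) (cproj c f) u = cproj c (rmul (Some w) f) u).
rewrite cprojE !rmulE; case E : (gmul _ _) => [x|/=]; last by case: ifP.
rewrite [LHS]cprojE; congr (if _ then _ else _); apply/idP/idP => [cx|cu].
  by move/gmulKr: E => /all_gmul; apply.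
by apply: (all_gmul E) => //; rewrite all_rinv.
Qed.

(** An operator T in the commutant of this set satisfies T xi_u = L_u (T xi_v),
    where v is the end of u, and T xi_v is supported on paths all of whose edges
    satisfy c. *)
Definition lmul_cproj c : set (H -> H) := [set cproj c] `|` range lmul.

Lemma vN_algebra_lmul_cproj c : vN_algebra (commutant (lmul_cproj c)).
Proof.
apply: vN_algebra_commutant => C [->|[w _ <-]].
- exact: bounded_pull.
- exact: bounded_pull.
- by exists (cproj c); [left|exact: adjoint_cproj].
- by exists (lmul (rinv w)); [right; exists (rinv w)|exact: adjoint_lmul].
Qed.

Lemma rmul_commutant c w : {mono @sinv G : e / c e} -> all c (rword w) ->
  commutant (lmul_cproj c) (@rmul R G (Some w)).
Proof.
move=> cV cw; split=> [|C [->|[u _ <-]]]; first exact: bounded_rmul.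
  by rewrite rmul_cproj.
by rewrite rmul_lmul.
Qed.

Lemma commutant_support c (T : H -> H) v w : commutant (lmul_cproj c) T ->
  T (delta (rvert v)) w != 0 -> all c (rword w) /\ rstart w = v.
Proof.
move=> Tc Tw; split.
  have cv : cproj c (delta (rvert v)) = delta (rvert v).
    apply: ell2P => x; rewrite cprojE deltaE; case: ifPn => // cx.
    by case: eqP => // xv; rewrite xv in cx.
  have : T (cproj c (delta (rvert v))) w = cproj c (T (delta (rvert v))) w.
    by rewrite (commutantE _ Tc)//; left.
  by rewrite cv cprojE; case: ifP => // _ T0; rewrite T0 eqxx in Tw.
have lv := lmul_delta (rvert v).
have : T (lmul (rvert v) (delta (rvert v))) w =
       lmul (rvert v) (T (delta (rvert v))) w.
  by rewrite (commutantE _ Tc)//; right; exists (rvert v).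
rewrite lv lmulE; case E: (gmul _ _) => [x|] /= T0.
  by have [<- _ _ _] := gmul_Some E; rewrite rend_rinv.
by rewrite T0 eqxx in Tw.
Qed.

(** T appends to each path of the support of f a path of colour c, which is
    nonempty because the diagonal of T vanishes, and nothing cancels by
    ends_in_gmul. *)
Lemma commutant_ends_in c (T : H -> H) f :
  {mono @sinv G : e / c e} -> commutant (lmul_cproj c) T ->
  (forall v, T (delta (rvert v)) (rvert v) = 0) ->
  (forall u, f u != 0 -> ~~ ends_in c u) ->
  forall x, T f x != 0 -> ends_in c x.
Proof.
move=> cV Tc T0 fc x; apply: contraNT => xc; apply/eqP.
apply: (bounded_op_eval0 (commutant_bounded Tc)) => u /fc uc.
apply/eqP; apply: contraNT xc.
rewrite -(lmul_delta u).
have -> : T (lmul u (delta (rvert (rend u)))) =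
          lmul u (T (delta (rvert (rend u)))).
  by rewrite (commutantE _ Tc)//; right; exists u.
rewrite lmulE; case E: (gmul _ _) => [y|] /=; last by rewrite eqxx.
move=> Ty; have [cy sy] := commutant_support Tc Ty.
move/gmulKl: E => E; apply: (ends_in_gmul cV E uc cy) => y0.
have yv : y = rvert (rend u) by exact: rpath_inj.
by move: Ty; rewrite yv T0 eqxx.
Qed.

End Multiplications.

(** * The conditional expectation *)

Section Expectation.
Variables (R : realType) (G : digraph).
Local Notation H := (ell2 R (rpath G)).
Implicit Types (f : H) (v : vert G) (w u x : rpath G) (T : H -> H).

Lemma coef_vert T v : coef T (rvert v) = T (delta (rvert v)) (rvert v).
Proof.
by rewrite /coef -[X in inner _ X]scale1r inner_deltar rmorph1 mulr1.
Qed.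

Lemma diag_sumE (d : vert G -> R[i]) (F : {fset vert G}) f w :
  (\sum_(v <- F) (d v *: @rmul R G (Some (rvert v))) f) w =
  if rend w \in F then d (rend w) * f w else 0.
Proof.
have E v : ((d v *: @rmul R G (Some (rvert v))) f) w =
    if rend w == v then d v * f w else 0.
  rewrite [LHS](_ : _ = d v * rmul (Some (rvert v)) f w)// rmul_vertE.
  by case: ifP; rewrite ?mulr0.
rewrite ell2_sum (eq_bigr _ (fun v _ => E v)); case: ifPn => wF.
  rewrite (big_fsetD1 _ wF) /= eqxx big_seq big1 ?Monoid.mulm1// => v.
  by rewrite in_fsetD1 eq_sym => /andP[/negPf ->].
rewrite big_seq big1// => v vF; case: eqP => // wv.
by rewrite wv vF in wF.
Qed.

(** The sum is the operator multiplying f w by d (rend w); it is approximated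
    by a partial sum over the ends of finitely many paths carrying all but a
    small part of f. *)
Lemma diag_opsummable (d : vert G -> R[i]) (M : R) :
  (forall v, normc (d v) <= M) ->
  opsummable (fun v => d v *: @rmul R G (Some (rvert v))).
Proof.
move=> dM.
have dfM f w : normc (d (rend w) * f w) <= M * normc (f w).
  by rewrite ComplexField.Normc.normcM ler_wpM2r ?normc_nneg.
have dP f : (fun w => d (rend w) * f w) \in @ell2_pred R (rpath G).
  exact: ell2_dom (dfM f).
pose T f : H := Ell2 (dP f).
have TE f w : T f w = d (rend w) * f w by [].
exists T; split.
  split=> [a f g|].
    by apply: ell2P => w; rewrite !(TE, ell2D, ell2Z) mulrDr mulrCA.
  exists `|M| => f; apply: l2norm_dom => // w; rewrite TE.
  by rewrite (le_trans (dfM f w))// ler_wpM2r ?normc_nneg ?ler_norm.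
move=> f; apply/cvgr0Pnorm_lt => e e0.
have M0 : 0 < `|M| + 1 by rewrite ltr_wpDl.
have [F /(_ F (fsubset_refl F)) hF] := l2norm_tail f (divr_gt0 e0 M0).
apply: (@near_totally _ _ [fset rend w | w in F]%fset) => F' FF'.
rewrite /= ger0_norm ?l2norm_ge0//.
apply: (@le_lt_trans _ _ (`|M| * l2norm (f - truncation f F))); last first.
  apply: (@le_lt_trans _ _ (`|M| * (e / (`|M| + 1)))); first exact: ler_wpM2l.
  by rewrite mulrA ltr_pdivrMr// mulrC ltr_pM2l// ltrDl.
apply: l2norm_dom => // w; rewrite !(ell2D, ell2N) diag_sumE truncationE TE.
case: ifPn => [wF'|wF'].
  by rewrite subrr ComplexField.Normc.normc0 mulr_ge0// normc_nneg.
have [wF|wF] := boolP (w \in F).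
  by move: wF'; rewrite (fsubsetP FF')//; apply/imfsetP; exists w.
by rewrite !subr0 (le_trans (dfM f w))// ler_wpM2r ?normc_nneg ?ler_norm.
Qed.

Lemma is_opsum_diag (d : vert G -> R[i]) T :
  is_opsum (fun v => d v *: @rmul R G (Some (rvert v))) T ->
  forall f w, T f w = d (rend w) * f w.
Proof.
move=> dT f w; apply/eqP; rewrite -subr_eq0; apply/eqP.
apply: ComplexField.Normc.eq0_normc; apply/le_anti; rewrite normc_nneg andbT.
apply/ler_addgt0Pr => e e0; rewrite add0r.
have [F /(_ _ (fsubsetUl F [fset rend w]%fset)) hF] := is_opsum_near dT f e0.
apply: le_trans (ltW hF); apply: le_trans (normc_le_l2norm _ w).
by rewrite ell2D ell2N diag_sumE !inE eqxx orbT.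
Qed.

Lemma coef_bounded T : bounded_op T ->
  exists M, forall v, normc (coef T (rvert v)) <= M.
Proof.
move=> /bounded_opP[_ [M M0 TM]]; exists M => v; rewrite coef_vert.
apply: le_trans (normc_le_l2norm _ _) _; apply: le_trans (TM _) _.
by rewrite ler_piMr// l2norm_delta_le.
Qed.

(** From left to right, the sum defining condexp T has to exist, as opsum takes
    the value 0 also on families which are not summable. *)
Lemma condexp_eq0 T : bounded_op T ->
  condexp T = 0 <-> forall v, T (delta (rvert v)) (rvert v) = 0.
Proof.
move=> bT; split=> [T0 v|T0].
  have [M /diag_opsummable sT] := coef_bounded bT.
  have := xgetPex 0 sT; rewrite -/(opsum _) -/(condexp T) T0.
  move=> /is_opsum_diag /(_ (delta (rvert v)) (rvert v)).
  by rewrite coef_vert deltaE eqxx mulr1 => <-.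
rewrite /condexp /opsum; case: xgetP => // S _ /is_opsum_diag TS.
apply/funext => f; apply: ell2P => w.
by rewrite TS coef_vert T0 mul0r.
Qed.

End Expectation.

(** * The labeling operators *)

Section Labeling.
Variables (R : realType) (G : digraph) (N : nat).
Variable omega : edge G -> 'rV[R[i]]_N.
Local Notation H := (ell2 R (rpath G)).
Implicit Types (f : H) (v : vert G) (w u x : rpath G) (e : sedge G).
Implicit Types (s : sign) (k : 'I_N) (T : H -> H).

Definition color k e : bool :=
  (slabel omega e == delta_mx 0 k) || (slabel omega e == - delta_mx 0 k).

Lemma slabel_sinv e : slabel omega (sinv e) = - slabel omega e.
Proof. by case: e => e /=; rewrite ?opprK. Qed.

Lemma color_sinv k : {mono @sinv G : e / color k e}.
Proof. by move=> e; rewrite /color slabel_sinv eqr_oppLR eqr_opp orbC. Qed.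

Lemma color_inj k k' e : color k e -> color k' e -> k = k'.
Proof.
have scal k1 : color k1 e ->
    exists2 a, a != 0 & slabel omega e = a *: delta_mx 0 k1.
  move=> /orP[]/eqP ->; first by exists 1; rewrite ?scale1r ?oner_eq0.
  by exists (-1); rewrite ?scaleN1r ?oppr_eq0 ?oner_eq0.
move=> /scal[a a0 ea] /scal[b _]; rewrite ea => /matrixP/(_ 0 k); rewrite !mxE !eqxx /= mulr1.
by have [//|_] := eqVneq k k'; rewrite mulr0 => /eqP; rewrite (negPf a0).
Qed.

Lemma color_slabel s k e : slabel omega e == slabel_value R s k -> color k e.
Proof. by rewrite /color; case: s => /= ->; rewrite ?orbT. Qed.

Definition opp_sign s := match s with Pos => Neg | Neg => Pos end.

Lemma slabel_value_opp s k :
  slabel_value R (opp_sign s) k = - slabel_value R s k.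
Proof. by case: s; rewrite //= opprK. Qed.

Hypothesis T_def : forall s k, opsummable (label_family omega s k).

Lemma is_opsum_klabeling s k :
  is_opsum (label_family omega s k) (klabeling omega s k).
Proof. exact: xgetPex (T_def s k). Qed.

Lemma bounded_klabeling s k : bounded_op (klabeling omega s k).
Proof. by case: (is_opsum_klabeling s k). Qed.

(** Each term of the sum contributes 0 or 1, and at most one of them contributes
    1, because u and x determine the edge e with x = u e. *)
Lemma klabeling_entry s k u x : klabeling omega s k (delta u) x =
  `[< exists2 e, slabel omega e == slabel_value R s k &
      gmul (Some u) (Some (redge e)) = Some x >]%:R.
Proof.
set b := `[< _ >].
pose fam := {e : sedge G | slabel omega e == slabel_value R s k}.
have E (e : fam) : label_family omega s k e (delta u) x =
    (gmul (Some u) (Some (redge (val e))) == Some x)%:R.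
  rewrite /label_family rmulE.
  have -> : oapp (delta u : H) 0 (gmul (Some x) (Some (rinv (redge (val e))))) =
      (gmul (Some x) (Some (rinv (redge (val e)))) == Some u)%:R.
    by case: (gmul _ _).
  by congr ((_ : bool)%:R); apply/eqP/eqP => /gmulKr.
have [F0 hF0] : exists F0 : {fset fam}, forall F : {fset fam},
    (F0 `<=` F)%fset ->
    (\sum_(e <- F) label_family omega s k e (delta u)) x = b%:R.
  have sumE (F : {fset fam}) :
    (\sum_(e <- F) label_family omega s k e (delta u)) x =
    \sum_(e <- F) (gmul (Some u) (Some (redge (val e))) == Some x)%:R.
    by rewrite ell2_sum; apply: eq_bigr => e _; exact: E.
  rewrite /b; case: asboolP => [[e0 e0s e0x]|nex]; last first.
    exists fset0 => F _; rewrite sumE big1// => e _; case: eqP => // ex.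
    by case: nex; exists (val e) => //; exact: (valP e).
  pose e0' : fam := exist _ e0 e0s.
  exists [fset e0']%fset => F /fsubsetP/(_ e0') eF; rewrite sumE.
  have e0'x : gmul (Some u) (Some (redge (val e0'))) = Some x by [].
  rewrite (big_fsetD1 e0') ?eF ?inE// e0'x eqxx big_seq big1 ?Monoid.mulm1//.
  move=> e; rewrite in_fsetD1 => /andP[/eqP ee0 _]; case: eqP => // ex.
  case: ee0; apply: val_inj => /=.
  by move/gmulKl: ex; have /gmulKl -> := e0x => -[].
apply/eqP; rewrite -subr_eq0; apply/eqP.
apply: ComplexField.Normc.eq0_normc; apply/le_anti; rewrite normc_nneg andbT.
apply/ler_addgt0Pr => r r0; rewrite add0r.
have [F /(_ _ (fsubsetUl F F0)) hF] :=
  is_opsum_near (is_opsum_klabeling s k) (delta u) r0.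
apply: le_trans (ltW hF); apply: le_trans (normc_le_l2norm _ x).
by rewrite ell2D ell2N hF0 ?fsubsetUr.
Qed.

Lemma klabeling_adjoint s k :
  adjoint (klabeling omega s k) (klabeling omega (opp_sign s) k).
Proof.
apply: adjoint_matrix => [||u x]; try exact: bounded_klabeling.
rewrite !klabeling_entry conjc_nat; congr ((_ : bool)%:R).
have sub s' u' x' : (exists2 e, slabel omega e == slabel_value R s' k &
      gmul (Some u') (Some (redge e)) = Some x') ->
    exists2 e, slabel omega e == slabel_value R (opp_sign s') k &
      gmul (Some x') (Some (redge e)) = Some u'.
  move=> [e es ex]; exists (sinv e).
    by rewrite slabel_sinv slabel_value_opp (eqP es).
  by rewrite -rinv_edge; apply/gmulKr.
apply/asboolP/asboolP => /sub //.
by case: s.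
Qed.

Lemma klabeling_vN (M : set (H -> H)) s k : vN_algebra M ->
  (forall e, color k e -> M (rmul (Some (redge e)))) -> M (klabeling omega s k).
Proof.
move=> vM Me; apply: (vN_algebra_opsum vM _ (is_opsum_klabeling s k)) => e.
by apply: Me; exact: color_slabel (valP e).
Qed.

Lemma diagonal_vN (M : set (H -> H)) : vN_algebra M ->
  (forall v, M (rmul (Some (rvert v)))) -> diagonal_alg R G `<=` M.
Proof.
move=> vM Mv T [d dT]; apply: (vN_algebra_opsum vM _ dT) => v.
exact: vN_algebraZ.
Qed.

(** This bounds the algebra generated by T_k + T_{-k} and the diagonal twice: by
    the right graph von Neumann algebra, and by the commutant of
    lmul_cproj (color k). *)
Lemma vN_gen_color (M : set (H -> H)) k : vN_algebra M ->
  (forall w, all (color k) (rword w) -> M (rmul (Some w))) ->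
  vN_gen ([set klabeling omega Pos k + klabeling omega Neg k] `|`
          diagonal_alg R G) `<=` M.
Proof.
move=> vM Mw; apply: vN_gen_le => // T [->|].
  by apply: vN_algebraD => //; apply: klabeling_vN => // e ke; apply: Mw;
     rewrite /= ke.
by apply: diagonal_vN => // v; exact: Mw.
Qed.

(** Downward induction on the index m of the leftmost factor. The induction
    step is commutant_ends_in: the paths reached so far end in the colour of the
    next factor to the right, so not in the colour of the factor m. *)
Lemma alternating_product (n : nat) (k : nat -> 'I_N) (a : nat -> H -> H) v :
  (forall i, (i < n)%N -> k i <> k i.+1) ->
  (forall i, (i <= n)%N -> commutant (lmul_cproj (color (k i))) (a i)) ->
  (forall i, (i <= n)%N -> forall v, a i (delta (rvert v)) (rvert v) = 0) ->
  forall m, (m <= n)%N -> forall x,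
  (\big[(fun S T => S \o T)/idfun]_(m <= i < n.+1) a i) (delta (rvert v)) x != 0
  -> ends_in (color (k m)) x.
Proof.
move=> kn ac a0 m mn; rewrite -(subKn mn).
elim: (n - m)%N (leq_subr m n) => {m mn} [_|j IHj jn] x.
  rewrite subn0 big_ltn// big_geq//; apply: (commutant_ends_in (color_sinv (k n))) => //.
  - exact: ac.
  - exact: a0.
  move=> u; have [->//|/negPf uv] := eqVneq u (rvert v).
  by rewrite deltaE uv eqxx.
have E : (n - j = (n - j.+1).+1)%N by rewrite subnS prednK// subn_gt0.
rewrite big_ltn; last by rewrite ltnS leq_subr.
set B := \big[_/_]_(_ <= i < _) a i.
change (a (n - j.+1)%N (B (delta (rvert v))) x != 0 ->
        ends_in (color (k (n - j.+1)%N)) x).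
apply: (commutant_ends_in (color_sinv _)); [exact/ac/leq_subr| |].
  exact/a0/leq_subr.
rewrite {}/B.
move=> u; rewrite -E => /(IHj (ltnW jn)).
rewrite /ends_in; case: (rword u) => // e p ke; apply/negP => ke'.
have /kn : (n - j.+1 < n)%N by rewrite -E leq_subr.
by case; rewrite -E; exact: color_inj ke' ke.
Qed.

End Labeling.

Theorem corollary5p5 (R : realType) (G : digraph) (N : nat)
    (omega : edge G -> 'rV[R[i]]_N)
    (G_lf : graph_locally_finite G) (G_conn : graph_connected G) (G_N : max_outdeg G N)
    (G_canon : canonical_weight omega)
    (T_def : forall (s : sign) (k : 'I_N),
      opsummable (label_family omega s k)) :
  let A := fun k : 'I_N => klabeling omega Pos k + klabeling omega Neg k in
  [/\ labeling omega = \sum_(k < N) A k,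
      rvN R G (labeling omega),
      forall k, rvN R G (A k)
    & free_over (rvN R G) (diagonal_alg R G) (@condexp R G)
        (fun k => vN_gen ([set A k] `|` diagonal_alg R G))]
  /\ selfadjoint (labeling omega).
Proof.
move=> A.
have labelingE : labeling omega = \sum_(k < N) A k.
  by rewrite /labeling addrC -big_split.
have rvNA k : rvN R G (A k).
  move=> M [vM rM]; apply: vN_algebraD => //; apply: klabeling_vN => // e _;
    by apply: rM; exists (Some (redge e)).
have Asub k : vN_gen ([set A k] `|` diagonal_alg R G) `<=` rvN R G.
  move=> T TA M [vM rM]; apply: (vN_gen_color T_def vM _ TA) => w _.
  by apply: rM; exists (Some w).
split; first split=> //.
- rewrite labelingE => M [vM rM]; elim/big_ind : _ => [|B C|k _].
  + exact: vN_algebra0.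
  + exact: vN_algebraD.
  + by apply: rvNA; split.
- split=> [k|n k a kn aP].
    by split=> //; apply: subset_trans (@sub_vN_gen _ _ _); right.
  have ac i : (i <= n)%N -> commutant (lmul_cproj (color omega (k i))) (a i).
    move=> /aP[aA _]; apply: (vN_gen_color T_def _ _ aA).
      exact: vN_algebra_lmul_cproj.
    by move=> w; apply: rmul_commutant; exact: color_sinv.
  have a0 i : (i <= n)%N -> forall v, a i (delta (rvert v)) (rvert v) = 0.
    move=> i_n; apply/condexp_eq0; first exact: commutant_bounded (ac i i_n).
    by case: (aP i i_n).
  apply/condexp_eq0.
    rewrite big_nat; elim/big_ind : _ => [|S T|i /andP[_ i_n]].
    + exact: bounded_op_id.
    + exact: bounded_op_comp.
    + exact: commutant_bounded (ac i i_n).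
  move=> v; apply/eqP; apply/negPn/negP.
  by move=> /(alternating_product kn ac a0 (leq0n n)).
- split.
    rewrite labelingE; elim/big_ind : _ => [|B C|k _].
    + exact: bounded_op0.
    + exact: bounded_opD.
    + by apply: bounded_opD; exact: bounded_klabeling.
  rewrite {2}/labeling addrC; apply: adjointD; apply: adjoint_sum => k.
    exact: (klabeling_adjoint T_def Neg).
  exact: (klabeling_adjoint T_def Pos).
Qed.
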